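(* Let $b\in\mathbb N$, $b\ge2$, $0<p\le\infty$, and let $S\subset L^p([0,1))$ be a finite-dimensional linear subspace closed under $b$-adic dilation. For any $\alpha>0$ and $0<q\le\infty$, the classes $N_q^\alpha(L^p)$, $C_q^\alpha(L^p)$ and $S_q^\alpha(L^p)$ are quasi-normed vector spaces and satisfy the continuous embeddings $$C_q^\alpha(L^p)\hookrightarrow S_q^\alpha(L^p)\hookrightarrow N_q^\alpha(L^p)\hookrightarrow C_q^{\alpha/2}(L^p).$$
   Context: Notation: $\mathbb N=\{1,2,\dots\}$, $\mathbb N_0=\mathbb N\cup\{0\}$, $I_b=\{0,\dots,b-1\}$, $L^p=L^p([0,1))$. $S$ is closed under $b$-adic dilation if $f(b^{-1}(\cdot+k))\in S$ for all $f\in S$, $0\le k\le b-1$. Tensorization: $t_{b,d}(i_1,\dots,i_d,y)=\sum_{k=1}^d i_kb^{-k}+b^{-d}y$ is a bijection $I_b^d\times[0,1)\to[0,1)$, $T_{b,d}f=f\circ t_{b,d}$. $\mathbf V_{b,d,S}=(\mathbb R^{I_b})^{\otimes d}\otimes S$ (functions on $I_b^d\times[0,1)$ with all partial evaluations $\boldsymbol f(j_1,\dots,j_d,\cdot)\in S$), $V_{b,d,S}=T_{b,d}^{-1}(\mathbf V_{b,d,S})$, $V_{b,S}=\bigcup_{d\in\mathbb N}V_{b,d,S}$. Ranks: for $\varphi\in V_{b,d,S}$ and $1\le\nu\le d$, $r_{\nu,d}(\varphi)$ is the rank of $T_{b,d}\varphi$ viewed as an order-two tensor in $(\mathbb R^{I_b})^{\otimes\nu}\otimes\big((\mathbb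 R^{I_b})^{\otimes(d-\nu)}\otimes S\big)$. Let $d(\varphi)=\min\{d\in\mathbb N:\varphi\in V_{b,d,S}\}$ and $r_\nu(\varphi)=r_{\nu,d(\varphi)}(\varphi)$. Tensor networks: fix a basis $\{\varphi_k\}_{k=1}^{\dim S}$ of $S$. For $d\in\mathbb N$, $\boldsymbol r=(r_1,\dots,r_d)\in\mathbb N^d$, let $\mathcal P_{b,d,S,\boldsymbol r}=\mathbb R^{b\times r_1}\times\mathbb R^{b\times r_1\times r_2}\times\cdots\times\mathbb R^{b\times r_{d-1}\times r_d}\times\mathbb R^{r_d\times\dim S}$, and for $\mathbf v=(v_1,\dots,v_{d+1})\in\mathcal P_{b,d,S,\boldsymbol r}$ let $\mathcal R_{b,d,S,\boldsymbol r}(\mathbf v)=T_{b,d}^{-1}\boldsymbol f$ with $$\boldsymbol f(i_1,\dots,i_d,y)=\sum_{k_1=1}^{r_1}\cdots\sum_{k_d=1}^{r_d}\sum_{k=1}^{\dim S}v_1^{k_1}(i_1)v_2^{k_1,k_2}(i_2)\cdots v_d^{k_{d-1},k_d}(i_d)\,v_{d+1}^{k_d,k}\,\varphi_k(y).$$ Complexities of $\varphi\in V_{b,S}$, with $d=d(\varphi)$: $\mathrm{compl}_{\mathcal N}(\varphi)=\sum_{\nu=1}^{d}r_\nu(\varphi)$; $\mathrm{compl}_{\mathcal C}(\varphi)=b\,r_1(\varphi)+b\sum_{k=2}^{d}r_{k-1}(\varphi)r_k(\varphi)+r_{d}(\varphi)\dim S$; $\mathrm{compl}_{\mathcal S}(\varphi)=\min\{\sum_{\nu=1}^{d'+1}\|v_\nu\|_{\ell_0}:\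 \mathcal R_{b,d',S,\boldsymbol r}(\mathbf v)=\varphi,\ d'\in\mathbb N,\ \boldsymbol r\in\mathbb N^{d'},\ \mathbf v\in\mathcal P_{b,d',S,\boldsymbol r}\}$, where $\|\cdot\|_{\ell_0}$ counts nonzero entries. For $\mathcal X\in\{\mathcal N,\mathcal C,\mathcal S\}$ and $n\in\mathbb N_0$: $\Phi_n^{\mathcal X}=\{\varphi\in V_{b,S}:\mathrm{compl}_{\mathcal X}(\varphi)\le n\}$. Approximation classes: for $\Phi=(\Phi_n)_{n\in\mathbb N_0}$ and $f\in L^p$, $E_n(f)=\inf_{\varphi\in\Phi_n}\|f-\varphi\|_p$; $\|f\|_{A_q^\alpha}=\big(\sum_{n\ge1}[n^\alpha E_{n-1}(f)]^q\frac1n\big)^{1/q}$ for $q<\infty$, $\|f\|_{A_\infty^\alpha}=\sup_{n\ge1}n^\alpha E_{n-1}(f)$; $A_q^\alpha(L^p,\Phi)=\{f\in L^p:\|f\|_{A_q^\alpha}<\infty\}$, with quasi-norm $\|\cdot\|_{A^\alpha_q}$. $N_q^\alpha(L^p)$, $C_q^\alpha(L^p)$, $S_q^\alpha(L^p)$ are $A_q^\alpha(L^p,\Phi)$ for $\Phi_n=\Phi_n^{\mathcal N},\Phi_n^{\mathcal C},\Phi_n^{\mathcal S}$ respectively. A continuous embedding $X\hookrightarrow Y$ means $X\subset Y$ and $\|f\|_Y\le C\|f\|_X$ for some constant $C$ and all $f\in X$. *)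

(* Defs.v *)
From HB Require Import structures.
From mathcomp Require Import all_boot all_order all_algebra.
From mathcomp Require Import all_classical all_reals all_analysis.
Set Implicit Arguments.
Unset Strict Implicit.
Unset Printing Implicit Defensive.
Import Order.TTheory GRing.Theory Num.Theory.
Import numFieldNormedType.Exports.
Local Open Scope classical_set_scope.
Local Open Scope ring_scope.

(* The space L^p([0,1)), 0 < p <= +oo, is represented by measurable functions
   R -> R, taken up to equality almost everywhere for [mu01]: the values outside
   [0,1) are irrelevant.  A subset of L^p([0,1)) is given by the set of all the
   representatives of its elements, and is therefore saturated for this
   equality; see [ae_saturated]. *)
Definition mu01 (R : realType) : {measure set (measurableTypeR R) -> \bar R} :=
  [the measure _ _ of mrestr (@lebesgue_measure R) (measurable_itv `[0%R, 1%R[)].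

Section LpSubspaces.
Context {R : realType}.
Local Notation mu := (mu01 R).
Implicit Types (p : \bar R) (A S : set (R -> R)).

Definition ae_saturated A := forall f g : R -> R,
  A f -> measurable_fun setT g -> f = g %[ae mu] -> A g.

Definition Lp_subspace p A :=
  [/\ forall f, A f -> f \in Lfun mu p,
      A (cst 0),
      forall (c : R) f g, A f -> A g -> A (fun x => c * f x + g x)
    & ae_saturated A].

(* A basis of [S] as a subspace of L^p, hence modulo a.e. equality.  In
   particular [m] is the dimension of [S]. *)
Definition Lp_basis S (m : nat) (phi : 'I_m -> R -> R) :=
  [/\ forall k, S (phi k),
      forall c : 'I_m -> R,
        (fun x => \sum_(k < m) c k * phi k x) = cst 0 %[ae mu] ->
        forall k, c k = 0
    & forall f, S f -> exists c : 'I_m -> R,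
        f = (fun x => \sum_(k < m) c k * phi k x) %[ae mu]].

Definition dilation_closed (b : nat) S :=
  forall f, S f -> forall k : 'I_b, S (fun x => f (b%:R^-1 * (x + k%:R))).

Definition quasinormed_space p A (N : (R -> R) -> \bar R) :=
  [/\ Lp_subspace p A,
      forall f g, A f -> A g -> f = g %[ae mu] -> N f = N g,
      forall f, A f -> (0 <= N f < +oo)%E /\
                       (N f = 0%E <-> f = cst 0 %[ae mu]),
      forall (c : R) f, A f -> N (fun x => c * f x) = (`|c|%:E * N f)%E
    & exists K : R, 1 <= K /\ forall f g, A f -> A g ->
        (N (fun x => f x + g x)%R <= K%:E * (N f + N g))%E].

Definition continuous_embedding A (N : (R -> R) -> \bar R)
    A' (N' : (R -> R) -> \bar R) :=
  A `<=` A' /\ exists K : R, forall f, A f -> (N' f <= K%:E * N f)%E.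

End LpSubspaces.

(* The minimum of a nonempty set of natural numbers (0 for the empty set). *)
Definition min_nat (P : set nat) : nat :=
  if pselect (exists n, `[< P n >]) is left exP then ex_minn exP else 0%N.

Section Tensorization.
Context {R : realType}.
Local Notation mu := (mu01 R).
Variable b : nat.

(* Digit positions are numbered from 0: [i k] is the digit i_(k+1). *)
Definition tmap (d : nat) (i : {ffun 'I_d -> 'I_b}) (y : R) : R :=
  \sum_(k < d) (i k)%:R * b%:R ^- k.+1 + b%:R ^- d * y.

Definition tensorize (d : nat) (f : R -> R) :
    {ffun 'I_d -> 'I_b} -> R -> R :=
  fun i y => f (tmap i y).
Arguments tensorize : clear implicits.

Definition tensor_eq (d : nat) (F G : {ffun 'I_d -> 'I_b} -> R -> R) :=
  forall i, F i = G i %[ae mu].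

Variable S : set (R -> R).

Definition tensor_space (d : nat) : set ({ffun 'I_d -> 'I_b} -> R -> R) :=
  [set F | forall j, S (F j)].

Definition Vd (d : nat) : set (R -> R) := [set f | tensor_space (tensorize d f)].

Definition Vb : set (R -> R) := [set f | exists2 d, (0 < d)%N & Vd d f].

(* [F] is a sum of [r] elementary tensors v_k (x) w_k, where the v_k depend on
   the first [nu] digits and the w_k on the last [e] digits and on y. *)
Definition sum_of_elementary (nu e : nat)
    (F : {ffun 'I_(nu + e) -> 'I_b} -> R -> R) (r : nat) :=
  exists (v : 'I_r -> {ffun 'I_nu -> 'I_b} -> R)
         (w : 'I_r -> {ffun 'I_e -> 'I_b} -> R -> R),
    (forall k, tensor_space (w k)) /\
    tensor_eq F (fun i y => \sum_(k < r)
      v k [ffun l => i (lshift e l)] * w k [ffun l => i (rshift nu l)] y).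

Definition tensor_rank (nu e : nat)
    (F : {ffun 'I_(nu + e) -> 'I_b} -> R -> R) : nat :=
  min_nat (sum_of_elementary F).

(* Used for 1 <= nu <= d only, so that nu + (d - nu) = d. *)
Definition rank_at (nu d : nat) (f : R -> R) : nat :=
  tensor_rank (tensorize (nu + (d - nu)) f).

Definition depth (f : R -> R) : nat :=
  min_nat [set d | (0 < d)%N /\ Vd d f].

Definition rank (nu : nat) (f : R -> R) : nat := rank_at nu (depth f) f.

End Tensorization.
Arguments tensorize {R b} d f i y.

(* Parameters of a tensor network of depth d = n + 1 >= 1; [r ord0], ...,
   [r ord_max] are r_1, ..., r_d, and [core_mid nu] is v_(nu+2). *)
Record tn_params (R : realType) (b n m : nat) (r : 'I_n.+1 -> nat) := TNParams {
  core_first : 'M[R]_(b, r ord0);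
  core_mid : forall nu : 'I_n, 'I_b ->
    'M[R]_(r (widen_ord (leqnSn n) nu), r (lift ord0 nu));
  core_last : 'M[R]_(r ord_max, m) }.

Section TensorNetworks.
Context {R : realType}.
Variables (b n m : nat) (r : 'I_n.+1 -> nat).
Implicit Types v : tn_params R b m r.

Definition tn_eval v (phi : 'I_m -> R -> R)
    (i : {ffun 'I_n.+1 -> 'I_b}) (y : R) : R :=
  \sum_(k : {dffun forall nu : 'I_n.+1, 'I_(r nu)}) \sum_(l < m)
    core_first v (i ord0) (k ord0) *
    (\prod_(nu < n) core_mid v nu (i (lift ord0 nu))
       (k (widen_ord (leqnSn n) nu)) (k (lift ord0 nu))) *
    core_last v (k ord_max) l * phi l y.

Definition l0_mx (s t : nat) (M : 'M[R]_(s, t)) : nat :=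
  #|[set ij : 'I_s * 'I_t | M ij.1 ij.2 != 0]%SET|.

Definition tn_l0 v : nat :=
  (l0_mx (core_first v) +
   \sum_(nu < n) \sum_(i < b) l0_mx (core_mid v nu i) +
   l0_mx (core_last v))%N.

(* f is the realization of v, i.e. f is the inverse image under tensorization
   of the tensor defined by v. *)
Definition tn_realizes v (phi : 'I_m -> R -> R) (f : R -> R) :=
  tensor_eq (tensorize n.+1 f) (tn_eval v phi).

End TensorNetworks.

Section Complexities.
Context {R : realType}.
Variables (b : nat) (S : set (R -> R)) (m : nat) (phi : 'I_m -> R -> R).
Implicit Type f : R -> R.

Definition compl_N f : nat :=
  (\sum_(1 <= nu < (depth b S f).+1) rank b S nu f)%N.

Definition compl_C f : nat :=
  (b * rank b S 1 f +
   b * (\sum_(2 <= k < (depth b S f).+1) rank b S k.-1 f * rank b S k f) +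
   rank b S (depth b S f) f * m)%N.

Definition compl_S f : nat :=
  min_nat [set c | exists (n : nat) (r : 'I_n.+1 -> nat) (v : tn_params R b m r),
    [/\ forall nu, (0 < r nu)%N, tn_realizes v phi f & c = tn_l0 v]].

Definition Phi (compl : (R -> R) -> nat) (n : nat) : set (R -> R) :=
  [set f | Vb b S f /\ (compl f <= n)%N].

End Complexities.

Section ApproximationClasses.
Context {R : realType}.
Local Notation mu := (mu01 R).
Variables (p : \bar R) (Phi : nat -> set (R -> R)).
Implicit Types (f : R -> R) (alpha : R) (q : \bar R).
Local Open Scope ereal_scope.

Definition best_error (n : nat) f : \bar R :=
  ereal_inf [set 'N[mu]_p[EFin \o (fun x => f x - g x)%R] | g in Phi n].

(* The summation index n >= 1 is written n.+1; the value at q = -oo is never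
   used. *)
Definition approx_norm alpha q f : \bar R :=
  match q with
  | q'%:E =>
      (\sum_(0 <= n <oo)
         ((n.+1%:R `^ alpha)%:E * best_error n f) `^ q' * (n.+1%:R^-1)%:E)
      `^ q'^-1
  | +oo => ereal_sup (range (fun n : nat =>
      (n.+1%:R `^ alpha)%:E * best_error n f))
  | -oo => 0
  end.

Definition approx_class alpha q : set (R -> R) :=
  [set f | f \in Lfun mu p /\ approx_norm alpha q f < +oo].

End ApproximationClasses.

(* Main.v *)
Require Import Defs.
From HB Require Import structures.
From mathcomp Require Import all_boot all_order all_algebra.
From mathcomp Require Import all_classical all_reals all_analysis.
From mathcomp Require Import measurable_realfun ess_sup_inf ring zify.
Set Implicit Arguments.
Unset Strict Implicit.
Unset Printing Implicit Defensive.
Import Order.TTheory GRing.Theory Num.Theory.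
Import numFieldNormedType.Exports.
Local Open Scope classical_set_scope.
Local Open Scope ring_scope.

(** For [nu <= depth f] the rank [r_nu(f)] is the dimension of the span in L^0 of
    the functions [f o tmap j], [j] in [I_b^nu], whatever the order of the tensor
    in which it is computed.  Hence [r_nu(f + g) <= r_nu(f) + r_nu(g)],
    [r_(nu+1) <= b r_nu], and [r_nu <= dim S] beyond the depth.  Up to constants
    compl_C is therefore the sum of the squares of the [r_nu], so that
    compl_N <= compl_C <= c compl_N^2 and the sets Phi_n of both complexities
    satisfy Phi_n + Phi_n `<=` Phi_(K n).  Choosing bases of the above spans among
    the [f o tmap j] gives a tensor network with at most compl_C(f) parameters,
    whereas in any network representing [f] the number of indices at level [nu]
    which are reached by a nonzero entry bounds [r_nu(f)]: thus
    compl_N <= compl_S <= compl_C.  Networks are added by direct sums, after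
    extending the shallower one with copies of the dilation matrices of [phi].
    The classes are then compared blockwise: the best errors with index in
    [K k^s, K (k+1)^s[ are bounded by the one of index [k]. *)

(** The rank of the definition refers to an order d and to S-valued factors, and the order may
    change when two functions are added; hence the intrinsic [rk], whose spanning functions are
    arbitrary. Factors selected among the sections f o tmap j return to S by themselves once the
    remaining digits are fixed. Networks, whose widths are dependent types, are replaced by the
    recursive predicate [chain] on families of functions, for which addition, extension and counting
    are inductions on the number of levels. Widths are positive whereas the ranks of the null
    function vanish, so this function is treated apart. A nonzero function has a positive rank, or a
    nonzero network entry, at every level: its complexity bounds its number of levels, and this pays
    for bringing two functions to a common depth. The comparison by blocks serves twice: with s = 1
    and blocks of K indices for the quasi-triangle inequality, and with s = 2 for the last
    embedding, where the square in compl_C <= c compl_N^2 is the source of alpha / 2. *)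

(** * Null sets of the restricted Lebesgue measure and affine maps *)

Section NullSets.
Context {R : realType}.
Local Notation mu := (mu01 R).
Local Notation leb := (@lebesgue_measure R).

(** The pushforward of Lebesgue measure under x -> a x + c, multiplied by a, gives ]u, v] its
    length, and Lebesgue measure is the only measure that does so. *)
Lemma lebesgue_measure_affine (a c : R) (A : set (measurableTypeR R)) : 0 < a ->
  measurable A -> leb A = (a%:E * leb ((fun x => a * x + c)%R @^-1` A))%E.
Proof.
move=> a0 mA.
have mg : @measurable_fun _ _ (measurableTypeR R) (measurableTypeR R) setT
    (fun x => a * x + c).
  by apply: measurable_funD => //; apply: measurable_funM.
pose k : {nonneg R} := NngNum (ltW a0).
pose m : {measure set (measurableTypeR R) -> \bar R} :=
  measure_function_pushforward__canonical__measure_function_Measure leb mg.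
pose nu : {measure set (measurableTypeR R) -> \bar R} :=
  [the measure _ _ of mscale k m].
rewrite (@lebesgue_measure_unique _ nu) //.
move=> X [[u v]/= _ <-]; rewrite /nu/= /mscale /= /pushforward /=.
have -> : (fun x : R => a * x + c) @^-1` `]u, v] = `](u - c) / a, (v - c) / a]%classic.
  by apply/seteqP; split => x /=; rewrite !in_itv/= ltr_pdivrMr// ler_pdivlMr//
    ltrBlDr lerBrDr (mulrC x).
rewrite !lebesgue_measure_itv /= !lte_fin ltr_pM2r ?invr_gt0// ltrD2r.
case: ifP => _; last by rewrite mule0.
by rewrite -EFinD -EFinD -EFinM; congr EFin; field; rewrite gt_eqF.
Qed.

Lemma negligible_affine (a c : R) (N : set (measurableTypeR R)) : 0 < a ->
  leb.-negligible N -> leb.-negligible ((fun x => a * x + c) @^-1` N).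
Proof.
move=> a0 [A [mA A0 NA]]; exists ((fun x => a * x + c) @^-1` A); split.
- rewrite -[X in measurable X]setTI.
  suff : @measurable_fun _ _ (measurableTypeR R) (measurableTypeR R) setT
    (fun x => a * x + c) by apply.
  by apply: measurable_funD => //; apply: measurable_funM.
- have /eqP := lebesgue_measure_affine c a0 mA.
  by rewrite A0 eq_sym mule_eq0 eqe gt_eqF//= => /eqP.
- exact: preimage_subset.
Qed.

Lemma mu01_negligibleP (N : set (measurableTypeR R)) :
  mu.-negligible N <-> leb.-negligible (N `&` `[0, 1[).
Proof.
split=> [[A [mA A0 NA]]|[A [mA A0 NA]]].
- exists (A `&` `[0, 1[); split => //; first exact: measurableI.
  exact: setSI.
(* The complement of [0, 1) is null for [mu01], so it can be added to any cover. *)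
- exists (A `|` ~` `[0, 1[%classic); split.
  + by apply: measurableU => //; exact: measurableC.
  + rewrite /= /mrestr setIUl [X in _ `|` X]setICl setU0.
    by apply: (@subset_measure0 _ _ _ leb _ A) => //; exact: measurableI.
  + move=> x Nx; have [x01|x01] := pselect (x \in `[0, 1[).
      by left; apply: NA.
    by right.
Qed.

Lemma mu01_aeP (P : R -> Prop) :
  (\forall x \ae mu, P x) <-> leb.-negligible [set x : R | (x \in `[0%R, 1%R[) /\ ~ P x].
Proof.
rewrite /prop_near1 /nbhs /= /almost_everywhere.
split=> [/mu01_negligibleP|H].
  by apply: negligibleS => x /= [? ?].
by apply/mu01_negligibleP; apply: negligibleS H => x /= [? ?].
Qed.

End NullSets.

#[export] Instance mu01_ae_filter (R : realType) :
  Filter (nbhs (almost_everywhere (mu01 R))).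
Proof. exact: (ae_filter_ringOfSetsType (mu01 R)). Qed.

(** * One b-adic subdivision of [0, 1) *)

Section Cells.
Context {R : realType} (b : nat) (hb : (0 < b)%N).
Local Notation mu := (mu01 R).

(** Affine map of [0, 1) onto its subinterval of index i, written as in [dilation_closed]; the maps
    [tmap] are composites of these. *)
Definition cell (i : 'I_b) (y : R) : R := b%:R^-1 * (y + i%:R).

Let b0 : 0 < b%:R :> R. Proof. by rewrite ltr0n. Qed.

Lemma cellK (i : 'I_b) : cancel (cell i) (fun x => b%:R * x - i%:R).
Proof. by move=> y; rewrite /cell; field; rewrite gt_eqF. Qed.

Lemma cellVK (i : 'I_b) : cancel (fun x => b%:R * x - i%:R) (cell i).
Proof. by move=> y; rewrite /cell; field; rewrite gt_eqF. Qed.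

Lemma cell01 (i : 'I_b) (y : R) : y \in `[0%R, 1%R[ -> cell i y \in `[0, 1[.
Proof.
rewrite !in_itv/= => /andP[y0 y1].
rewrite /cell mulr_ge0 ?invr_ge0 ?addr_ge0 ?ler0n//= mulrC ltr_pdivrMr// mul1r.
apply: (@lt_le_trans _ _ (i.+1)%:R); last by rewrite ler_nat.
by rewrite -natr1 addrC ltrD2l.
Qed.

(** On [0, 1) the truncation is below b; the default of [insubd] only gives a value outside this
    interval. *)
Definition digit (x : R) : 'I_b := insubd (Ordinal hb) (Num.trunc (b%:R * x)).
Definition digit_frac (x : R) : R := b%:R * x - (digit x)%:R.

Lemma cell_digit (x : R) : cell (digit x) (digit_frac x) = x.
Proof. exact: cellVK. Qed.

Lemma digit_frac01 (x : R) : x \in `[0%R, 1%R[ -> digit_frac x \in `[0, 1[.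
Proof.
rewrite !in_itv/= => /andP[x0 x1]; rewrite /digit_frac /digit val_insubd.
have bx0 : 0 <= b%:R * x by rewrite mulr_ge0 ?ler0n.
have /andP[h1 h2] := truncn_itv bx0.
rewrite ifT; first by rewrite subr_ge0 h1/= ltrBlDr addrC natr1.
rewrite -(ltr_nat R) (le_lt_trans h1)// -[ltRHS]mulr1 ltr_pM2l//.
Qed.

Lemma digit_cell (i : 'I_b) (y : R) : y \in `[0%R, 1%R[ -> digit (cell i y) = i.
Proof.
rewrite !in_itv/= => /andP[y0 y1]; apply: val_inj; rewrite /digit val_insubd.
have -> : Num.trunc (b%:R * cell i y) = i.
  rewrite (_ : b%:R * cell i y = y + i%:R); last first.
    by rewrite /cell; field; rewrite gt_eqF.
  apply/eqP; rewrite truncn_eq; last by rewrite addr_ge0 ?ler0n.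
  by rewrite lerDr y0 /= -natr1 addrC ltrD2l.
by rewrite ltn_ord.
Qed.

Lemma ae_cell (P : R -> Prop) (i : 'I_b) :
  (\forall x \ae mu, P x) -> \forall y \ae mu, P (cell i y).
Proof.
move=> /mu01_aeP H; apply/mu01_aeP.
have := @negligible_affine R b%:R^-1 (b%:R^-1 * i%:R) _ _ H.
rewrite invr_gt0 => /(_ b0); apply: negligibleS => y /= [y01 nP].
by rewrite -mulrDr; split => //; exact: cell01.
Qed.

(** The exceptional set in [0, 1) is covered by the b images of the exceptional sets of the cells.
    Each image is written as a preimage under the inverse affine map, so that [negligible_affine]
    applies. *)
Lemma ae_cells (P : R -> Prop) :
  (forall i, \forall y \ae mu, P (cell i y)) -> \forall x \ae mu, P x.
Proof.
move=> H; apply/mu01_aeP.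
have : (@lebesgue_measure R).-negligible (\big[setU/set0]_(i < b)
    ((fun x => b%:R * x + - i%:R) @^-1` [set y : R | (y \in `[0%R, 1%R[) /\ ~ P (cell i
        y)])).
  elim/big_ind: _ => [||i _]; [exact: negligible_set0|move=> A B; exact: (@negligibleU
      _ (measurableTypeR R) R lebesgue_measure)|].
  apply: negligible_affine => //.
  by apply/mu01_aeP; exact: H.
apply: negligibleS => x /= [x01 nP].
rewrite -bigcup_seq /=; exists (digit x); first by rewrite /= mem_index_enum.
split; first exact: digit_frac01.
by rewrite cell_digit.
Qed.

End Cells.

(** * Minima of sets of natural numbers *)

Section MinNat.
Implicit Types P Q : set nat.

Lemma min_nat_in P n : P n -> P (min_nat P).
Proof.
move=> Pn; rewrite /min_nat; case: pselect => [e|[]]; last first.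
  by exists n; apply/asboolP.
by case: ex_minnP => m /asboolP.
Qed.

Lemma min_nat_le P n : P n -> (min_nat P <= n)%N.
Proof.
move=> Pn; rewrite /min_nat; case: pselect => [e|//].
by case: ex_minnP => m _; apply; apply/asboolP.
Qed.

Lemma min_nat_le_min P Q : P !=set0 -> (forall n, P n -> exists2 k, (k <= n)%N & Q k) ->
  (min_nat Q <= min_nat P)%N.
Proof.
move=> [n /min_nat_in Pm] /(_ _ Pm)[k km Qk].
exact: leq_trans (min_nat_le Qk) km.
Qed.

(** Each set reaches at or below every element of the other. If one set is empty so is the other,
    and both minima are the default value 0. *)
Lemma eq_min_nat P Q : (forall n, P n -> exists2 k, (k <= n)%N & Q k) ->
  (forall n, Q n -> exists2 k, (k <= n)%N & P k) -> min_nat P = min_nat Q.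
Proof.
move=> PQ QP; have [[n Pn]|P0] := pselect (P !=set0).
  have [k _ Qk] := PQ _ Pn.
  by apply/eqP; rewrite eqn_leq !min_nat_le_min//; [exists n|exists k].
rewrite /min_nat; case: pselect => [e|_].
  by exfalso; case: e => n /asboolP Pn; apply: P0; exists n.
case: pselect => [e|//].
by exfalso; case: e => n /asboolP Qn; apply: P0; have [k _ Pk] := QP _ Qn; exists k.
Qed.

End MinNat.

(** * Finite spans modulo null sets *)

Section AeSpan.
Context {R : realType}.
Local Notation mu := (mu01 R).
Implicit Types f g h : R -> R.

Definition aespan r (w : 'I_r -> R -> R) g :=
  exists L : 'I_r -> R, \forall x \ae mu, g x = \sum_(k < r) L k * w k x.

Lemma ae_forall (I : finType) (P : I -> R -> Prop) :
  (forall i, \forall x \ae mu, P i x) -> \forall x \ae mu, forall i, P i x.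
Proof.
move=> H; suff : \forall x \ae mu, forall i, i \in enum I -> P i x.
  by apply: filterS => x + i; apply; rewrite mem_enum.
elim: (enum I) => [|i s IH]; first by apply: aeW.
apply: filterS2 (H i) IH => x Pi Ps j; rewrite inE => /orP[/eqP->//|]; exact: Ps.
Qed.

Lemma aespan_ae r (w : 'I_r -> R -> R) f g : (\forall x \ae mu, f x = g x) ->
  aespan w f -> aespan w g.
Proof.
by move=> fg [L H]; exists L; apply: filterS2 fg H => x -> ->.
Qed.

Lemma aespan_sum r (w : 'I_r -> R -> R) (I : finType) (c : I -> R) (g : I -> R -> R) :
  (forall i, aespan w (g i)) -> aespan w (fun x => \sum_i c i * g i x).
Proof.
move=> /choice[L HL]; exists (fun k => \sum_i c i * L i k).
apply: filterS (ae_forall HL) => x Hx.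
under eq_bigr do rewrite Hx big_distrr/=.
rewrite exchange_big/=; apply: eq_bigr => k _.
by rewrite big_distrl/=; apply: eq_bigr => i _; rewrite mulrA.
Qed.

Lemma aespan_mem r (w : 'I_r -> R -> R) k : aespan w (w k).
Proof.
exists (fun l => (l == k)%:R); apply: aeW => x.
rewrite (bigD1 k)//= eqxx mul1r big1 ?addr0// => l /negbTE ->.
by rewrite mul0r.
Qed.

Lemma aespan0 r (w : 'I_r -> R -> R) g : (\forall x \ae mu, g x = 0) -> aespan w g.
Proof.
move=> g0; exists (fun=> 0); apply: filterS g0 => x ->.
by rewrite big1// => k _; rewrite mul0r.
Qed.

End AeSpan.

(** * The maps attached to strings of digits *)

Section DigitMaps.
Context {R : realType} (b : nat) (hb : (0 < b)%N).
Local Notation mu := (mu01 R).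

Let b0 : b%:R != 0 :> R. Proof. by rewrite pnatr_eq0 -lt0n. Qed.

Lemma tmap0 (i : {ffun 'I_0 -> 'I_b}) (y : R) : tmap i y = y.
Proof. by rewrite /tmap big_ord0 add0r expr0 invr1 mul1r. Qed.

(** The first digit is the coarsest one, hence the outermost cell map. *)
Lemma tmapS d (i : {ffun 'I_d.+1 -> 'I_b}) (y : R) :
  tmap i y = cell (i ord0) (tmap [ffun l => i (lift ord0 l)] y).
Proof.
rewrite /tmap /cell big_ord_recl expr1 [RHS]mulrDr [RHS]addrC mulrC -addrA.
congr (_ + _); rewrite mulrDr big_distrr/= exprS invfM mulrA; congr (_ + _).
by apply: eq_bigr => k _; rewrite ffunE exprS invfM mulrCA.
Qed.

Lemma tmap_cat d e (i : {ffun 'I_(d + e) -> 'I_b}) (y : R) :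
  tmap i y = tmap [ffun l => i (lshift e l)] (tmap [ffun l => i (rshift d l)] y).
Proof.
rewrite /tmap big_split_ord/= mulrDr addrA exprD invfM mulrA; congr (_ + _ + _).
  by apply: eq_bigr => k _; rewrite ffunE.
rewrite big_distrr/=; apply: eq_bigr => k _.
by rewrite ffunE -addnS exprD invfM mulrCA.
Qed.

Definition dcons d (a : 'I_b) (i : {ffun 'I_d -> 'I_b}) : {ffun 'I_d.+1 -> 'I_b} :=
  [ffun l => if unlift ord0 l is Some l' then i l' else a].

Lemma dcons0 d a (i : {ffun 'I_d -> 'I_b}) : dcons a i ord0 = a.
Proof. by rewrite ffunE unlift_none. Qed.

Lemma dconsS d a (i : {ffun 'I_d -> 'I_b}) l : dcons a i (lift ord0 l) = i l.
Proof. by rewrite ffunE liftK. Qed.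

Lemma dcons_tail d a (i : {ffun 'I_d -> 'I_b}) : [ffun l => dcons a i (lift ord0 l)] = i.
Proof. by apply/ffunP => l; rewrite ffunE dconsS. Qed.

Lemma tmap_dcons d a (i : {ffun 'I_d -> 'I_b}) (y : R) :
  tmap (dcons a i) y = cell a (tmap i y).
Proof. by rewrite tmapS dcons0 dcons_tail. Qed.

Definition dcat d e (i : {ffun 'I_d -> 'I_b}) (j : {ffun 'I_e -> 'I_b}) :
    {ffun 'I_(d + e) -> 'I_b} :=
  [ffun l => match fintype.split l with inl u => i u | inr u => j u end].

Lemma dcatl d e (i : {ffun 'I_d -> 'I_b}) (j : {ffun 'I_e -> 'I_b}) :
  [ffun l => dcat i j (lshift e l)] = i.
Proof.
apply/ffunP => l; rewrite !ffunE.
by rewrite -[lshift e l]/(unsplit (inl l)) unsplitK.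
Qed.

Lemma dcatr d e (i : {ffun 'I_d -> 'I_b}) (j : {ffun 'I_e -> 'I_b}) :
  [ffun l => dcat i j (rshift d l)] = j.
Proof.
apply/ffunP => l; rewrite !ffunE.
by rewrite -[rshift d l]/(unsplit (inr l)) unsplitK.
Qed.

Lemma tmap_dcat d e (i : {ffun 'I_d -> 'I_b}) (j : {ffun 'I_e -> 'I_b}) (y : R) :
  tmap (dcat i j) y = tmap i (tmap j y).
Proof. by rewrite tmap_cat dcatl dcatr. Qed.

Lemma ae_tmap (P : R -> Prop) d (i : {ffun 'I_d -> 'I_b}) :
  (\forall x \ae mu, P x) -> \forall y \ae mu, P (tmap i y).
Proof.
elim: d P i => [|d IH] P i H; first by apply: filterS H => x; rewrite tmap0.
have := IH _ [ffun l => i (lift ord0 l)] (ae_cell hb (i ord0) H).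
by apply: filterS => x; rewrite tmapS.
Qed.

Lemma ae_tmaps d (P : R -> Prop) :
  (forall i : {ffun 'I_d -> 'I_b}, \forall y \ae mu, P (tmap i y)) ->
  \forall x \ae mu, P x.
Proof.
elim: d P => [|d IH] P H.
  have i0 : {ffun 'I_0 -> 'I_b} := [ffun=> Ordinal hb].
  by apply: filterS (H i0) => x; rewrite tmap0.
apply: (ae_cells hb) => a; apply: (IH (fun x => P (cell a x))) => i.
by apply: filterS (H (dcons a i)) => y; rewrite tmap_dcons.
Qed.

(** Each [tmap i] is an affine bijection of the whole line, so f is f o tmap i composed with an
    affine inverse; the proof takes i constantly zero. *)
Lemma measurable_tmaps d f :
  (forall i : {ffun 'I_d -> 'I_b}, measurable_fun setT (fun y : R => f (tmap i y) : R)) ->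
  measurable_fun setT f.
Proof.
move=> /(_ [ffun=> Ordinal hb]) H.
pose c : R := \sum_(k < d) (Ordinal hb : nat)%:R * b%:R ^- k.+1.
have -> : f = (fun y => f (tmap ([ffun=> Ordinal hb] : {ffun 'I_d -> 'I_b}) y))
    \o (fun x => b%:R ^+ d * (x - c)).
  apply/funext => x /=; congr f; rewrite /tmap.
  under eq_bigr do rewrite ffunE.
  by rewrite -/c mulrA mulVf ?expf_neq0// mul1r addrC subrK.
apply: measurableT_comp => //; apply: measurable_funM => //.
exact: measurable_funB.
Qed.

End DigitMaps.

(** The rows v j of a matrix are combinations of a maximal independent set of them. Applied to
    coefficients in a spanning family, this yields a spanning family taken among the spanned
    functions themselves. *)
Lemma row_selection (R : fieldType) (J : finType) r (v : J -> 'I_r -> R) :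
  exists rho (s : 'I_rho -> J) (L : J -> 'I_rho -> R), (rho <= r)%N /\
    forall j k, v j k = \sum_(l < rho) L j l * v (s l) k.
Proof.
pose A : 'M[R]_(#|J|, r) := \matrix_(i, k) v (enum_val i) k.
exists (\rank A), (fun l => enum_val (maxrankfun A l)).
have AS j : (row (enum_rank j) A <= rowsub (maxrankfun A) A)%MS.
  by rewrite eq_maxrowsub row_sub.
have /choice[L HL] : forall j, exists L : 'rV_(\rank A), row (enum_rank j) A = L *m
    rowsub (maxrankfun A) A.
  by move=> j; exact/submxP.
exists (fun j l => L j ord0 l); split; first exact: rank_leq_col.
move=> j k; have /matrixP/(_ ord0 k) := HL j.
rewrite !mxE enum_rankK => ->; apply: eq_bigr => l _.
by rewrite !mxE.
Qed.

(** * Ranks as dimensions of spans of sections *)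

Section IntrinsicRank.
Context {R : realType} (b : nat) (hb : (0 < b)%N).
Local Notation mu := (mu01 R).
Implicit Types f g : R -> R.

(** The functions w k are arbitrary: neither S nor the order of the tensor enters, which is what
    makes [rk] independent of the depth. *)
Definition rk_le nu f : set nat := [set r | exists w : 'I_r -> R -> R,
  forall j : {ffun 'I_nu -> 'I_b}, aespan w (fun y => f (tmap j y))].

Definition rk nu f := min_nat (rk_le nu f).

(** The functions f o tmap j span themselves, so the set of candidates is nonempty and its minimum
    is attained. *)
Lemma rk_lein nu f : rk_le nu f (rk nu f).
Proof.
apply: (@min_nat_in _ #|{ffun 'I_nu -> 'I_b}|).
exists (fun k y => f (tmap (enum_val k : {ffun 'I_nu -> 'I_b}) y)) => j.
have := aespan_mem (fun k y => f (tmap (enum_val k : {ffun 'I_nu -> 'I_b}) y))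
    (enum_rank j).
by rewrite enum_rankK.
Qed.

Lemma rk_selection nu f r : rk_le nu f r ->
  exists rho (s : 'I_rho -> {ffun 'I_nu -> 'I_b}) (L : {ffun 'I_nu -> 'I_b} -> 'I_rho
      -> R),
    (rho <= r)%N /\
    forall j, \forall y \ae mu, f (tmap j y) = \sum_(l < rho) L j l * f (tmap (s l) y).
Proof.
move=> [w /choice[v Hv]]; have [rho [s [L [rr HL]]]] := row_selection v.
exists rho, s, L; split=> // j.
apply: filterS (ae_forall Hv) => y Hy; rewrite Hy.
under [RHS]eq_bigr do rewrite Hy big_distrr/=.
rewrite exchange_big/=; apply: eq_bigr => k _.
by rewrite HL big_distrl/=; apply: eq_bigr => l _; rewrite mulrA.
Qed.

Lemma rk_basis nu f :
  exists (s : 'I_(rk nu f) -> {ffun 'I_nu -> 'I_b}) (L : {ffun 'I_nu -> 'I_b} -> 'I_(rk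
      nu f) -> R),
    forall j, \forall y \ae mu, f (tmap j y) = \sum_(l < rk nu f) L j l * f (tmap (s l)
        y).
Proof.
have [rho [s [L [rr HL]]]] := rk_selection (rk_lein nu f).
(* The selected sections span, so rho is itself a candidate and minimality forces rho = rk nu f. *)
have : rk_le nu f rho by exists (fun l y => f (tmap (s l) y)) => j; exists (L j).
move=> /min_nat_le; rewrite -/(rk nu f) => rr'.
have E : rho = rk nu f by apply/eqP; rewrite eqn_leq rr.
by rewrite -E; exists s, L.
Qed.

Variable S : set (R -> R).

(** Rows are selected in both directions. From elementary tensors, selecting among the rows of
    coefficients v k j provides sections of f, already functions of a real variable, and spares
    gluing the w k together. Conversely, selected sections restricted by the last e digits are
    entries of the tensor of f, hence belong to S. *)
Lemma tensor_rankE nu e f : Vd b S (nu + e) f ->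
  tensor_rank S (@tensorize R b (nu + e) f) = rk nu f.
Proof.
move=> Vf; apply: eq_min_nat => r.
- move=> [v [w [Sw H]]].
  have [rho [s [L [rr HL]]]] := row_selection (fun j k => v k j).
  exists rho => //; exists (fun l y => f (tmap (s l) y)) => j; exists (L j).
  apply: (@ae_tmaps _ b hb e) => i.
  have Hj j' : \forall y \ae mu, f (tmap j' (tmap i y)) = \sum_(k < r) v k j' * w k i y.
    have := H (dcat j' i); apply: filterS => y /(_ I).
    by rewrite /tensorize tmap_dcat dcatl dcatr.
  apply: filterS (ae_forall Hj) => y Hy.
  rewrite Hy; under [RHS]eq_bigr do rewrite Hy big_distrr/=.
  rewrite exchange_big/=; apply: eq_bigr => k _.
  by rewrite HL big_distrl/=; apply: eq_bigr => l _; rewrite mulrA.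
- move=> /rk_selection[rho [s [L [rr HL]]]]; exists rho => //.
  exists (fun l j => L j l), (fun l i y => f (tmap (s l) (tmap i y))); split.
    move=> l i; have := Vf (dcat (s l) i); congr S.
    by apply/funext => y; rewrite /tensorize tmap_dcat.
  move=> i; apply: filterS (ae_tmap hb [ffun l => i (rshift nu l)] (HL [ffun l => i
      (lshift e l)])).
  by move=> y Hy _; rewrite /tensorize tmap_cat Hy.
Qed.

Lemma rankE nu f : (nu <= depth b S f)%N -> Vb b S f -> rank b S nu f = rk nu f.
Proof.
move=> nud [d d0 Vf]; have [_ V] : (0 < depth b S f)%N /\ Vd b S (depth b S f) f.
  exact: (@min_nat_in [set d | (0 < d)%N /\ Vd b S d f] d).
by rewrite /rank /rank_at tensor_rankE// subnKC.
Qed.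

End IntrinsicRank.

(** * Behaviour of the ranks under sums, scaling and refinement *)

Section RankBounds.
Context {R : realType} (b : nat) (hb : (0 < b)%N).
Local Notation mu := (mu01 R).
Local Notation rk := (rk b).
Implicit Types f g : R -> R.

Lemma rk_le_card nu f (I : finType) (w : I -> R -> R) :
  (forall j : {ffun 'I_nu -> 'I_b}, exists L : I -> R,
     \forall y \ae mu, f (tmap j y) = \sum_i L i * w i y) ->
  (rk nu f <= #|I|)%N.
Proof.
move=> H; apply: min_nat_le; exists (fun k => w (enum_val k)) => j.
have [L HL] := H j; exists (fun k => L (enum_val k)).
apply: filterS HL => y ->; rewrite (reindex (@enum_val I predT))//=.
by exists (@enum_rank I) => i _; rewrite ?enum_valK ?enum_rankK.
Qed.

Lemma rkD nu f g : (rk nu (fun x => f x + g x)%R <= rk nu f + rk nu g)%N.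
Proof.
have [w Hw] := rk_lein b nu f; have [v Hv] := rk_lein b nu g.
have := @rk_le_card nu (fun x => f x + g x) ('I_(rk nu f) + 'I_(rk nu g))%type
  (fun k => match k with inl k => w k | inr k => v k end).
rewrite card_sum !card_ord; apply=> j.
have [L HL] := Hw j; have [L' HL'] := Hv j.
exists (fun k => match k with inl k => L k | inr k => L' k end).
by apply: filterS2 HL HL' => y -> ->; rewrite big_sumType.
Qed.

Lemma rkZ_le nu (c : R) f : (rk nu (fun x => c * f x)%R <= rk nu f)%N.
Proof.
have [w Hw] := rk_lein b nu f.
apply: min_nat_le; exists w => j; have [L HL] := Hw j; exists (fun k => c * L k).
apply: filterS HL => y ->; rewrite big_distrr/=.
by apply: eq_bigr => k _; rewrite mulrA.
Qed.

Lemma rkZ nu (c : R) f : c != 0 -> rk nu (fun x => c * f x) = rk nu f.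
Proof.
move=> c0; apply/eqP; rewrite eqn_leq rkZ_le/=.
have := rkZ_le nu c^-1 (fun x => c * f x); congr (rk nu _ <= _)%N.
by apply/funext => x; rewrite mulKf.
Qed.

Lemma rk_ae0 nu f : (\forall x \ae mu, f x = 0) -> rk nu f = 0%N.
Proof.
move=> f0; apply/eqP; rewrite -leqn0; apply: min_nat_le.
exists (fun=> cst 0) => j; apply: aespan0; exact: (ae_tmap hb j f0).
Qed.

(** An empty span makes every section null, and at any level nu the cells cover [0, 1). *)
Lemma rk_eq0 nu f : rk nu f = 0%N -> \forall x \ae mu, f x = 0.
Proof.
move=> r0; have := rk_lein b nu f; rewrite r0 => -[w Hw].
apply: (@ae_tmaps _ b hb nu) => j; have [L] := Hw j.
by apply: filterS => y ->; rewrite big_ord0.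
Qed.

Lemma rk0_le1 f : (rk 0 f <= 1)%N.
Proof.
apply: min_nat_le; exists (fun=> f) => j; exists (fun=> 1).
by apply: aeW => y; rewrite tmap0 big_ord1 mul1r.
Qed.

(** A further digit a replaces the spanning functions w k by w k o cell a; letting a vary gives b
    times as many functions. *)
Lemma rkS nu f : (rk nu.+1 f <= b * rk nu f)%N.
Proof.
have [w Hw] := rk_lein b nu f.
have := @rk_le_card nu.+1 f ('I_b * 'I_(rk nu f))%type (fun k y => w k.2 (cell k.1 y)).
rewrite card_prod !card_ord; apply; rewrite -addn1 => j.
pose i := [ffun l => j (lshift 1 l)].
pose a := [ffun l => j (rshift nu l)] ord0.
have [L HL] := Hw i; exists (fun k => L k.2 *+ (k.1 == a)).
apply: filterS (ae_cell hb a HL) => y Hy.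
rewrite tmap_cat tmapS tmap0 Hy.
rewrite -(pair_bigA _ (fun a' k => L k *+ (a' == a) * w k (cell a' y)))/=.
rewrite (bigD1 a)//= eqxx [X in _ = _ + X]big1 ?addr0//.
by move=> a' /negbTE ->; rewrite big1// => k _; rewrite mul0r.
Qed.

End RankBounds.

(** * The spaces V_d, depths, and the complexities as sums over ranks *)

Section DyadicSpaces.
Context {R : realType} (b : nat) (hb : (0 < b)%N) (p : \bar R).
Local Notation mu := (mu01 R).
Local Notation rk := (rk b).
Variables (S : set (R -> R)) (hS : Lp_subspace p S).
Variables (m : nat) (phi : 'I_m -> R -> R) (hphi : Lp_basis S phi).
Hypothesis hdil : dilation_closed b S.
Local Notation Vd := (Vd b S).
Local Notation Vb := (Vb b S).
Local Notation depth := (depth b S).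
Implicit Types f g : R -> R.

Lemma S_measurable f : S f -> measurable_fun setT f.
Proof.
by case: hS => SL _ _ _ /SL /sub_Lfun_mfun; rewrite inE.
Qed.

Lemma Vd_measurable d f : Vd d f -> measurable_fun setT f.
Proof. move=> Vf; apply: (@measurable_tmaps _ b hb d) => i; exact: (S_measurable (Vf
    i)). Qed.

Lemma Vb_measurable f : Vb f -> measurable_fun setT f.
Proof. by move=> [d _ /Vd_measurable]. Qed.

Lemma measurable_tmap d (i : {ffun 'I_d -> 'I_b}) f :
  measurable_fun setT f -> measurable_fun setT (fun y : R => f (tmap i y) : R).
Proof.
move=> mf; apply: measurableT_comp => //; exact: measurable_funD.
Qed.

Lemma Vd_ae d f : measurable_fun setT f ->
  (forall i : {ffun 'I_d -> 'I_b}, exists2 g, S g & \forall y \ae mu, f (tmap i y) = g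
      y) ->
  Vd d f.
Proof.
move=> mf H i; have [g Sg fg] := H i; case: hS => _ _ _ Sae.
apply: (Sae g) => //; first exact: measurable_tmap.
by apply: filterS fg => y Hy _.
Qed.

(** Appending a last digit composes a section with one of the dilations under which S is closed. *)
Lemma VdS d f : Vd d f -> Vd d.+1 f.
Proof.
move=> Vf; rewrite -addn1 => j.
have := hdil (Vf [ffun l => j (lshift 1 l)]) ([ffun l => j (rshift d l)] ord0).
by congr S; apply/funext => y; rewrite /tensorize tmap_cat tmapS tmap0.
Qed.

Lemma Vd_leq d e f : (d <= e)%N -> Vd d f -> Vd e f.
Proof.
move=> /subnKC <-; elim: (e - d)%N => [|k IH]; first by rewrite addn0.
by move=> /IH; rewrite addnS; exact: VdS.
Qed.

Lemma Vd_lin d c f g : Vd d f -> Vd d g -> Vd d (fun x => c * f x + g x).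
Proof. by case: hS => _ _ SL _ Vf Vg j; exact: (SL c _ _ (Vf j) (Vg j)). Qed.

Lemma VdD d f g : Vd d f -> Vd d g -> Vd d (fun x => f x + g x).
Proof.
move=> Vf Vg; have := Vd_lin 1 Vf Vg.
by under eq_fun do rewrite mul1r.
Qed.

Lemma Vd0 d : Vd d (cst 0).
Proof. by case: hS => _ S0 _ _ j. Qed.

Lemma VdZ d c f : Vd d f -> Vd d (fun x => c * f x).
Proof.
move=> Vf; have := Vd_lin c Vf (@Vd0 d).
by under eq_fun do rewrite addr0.
Qed.

Lemma Vb0 : Vb (cst 0). Proof. by exists 1%N => //; exact: Vd0. Qed.

Lemma VbZ c f : Vb f -> Vb (fun x => c * f x).
Proof. by move=> [d d0 Vf]; exists d => //; exact: VdZ. Qed.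

Lemma depthP f : Vb f -> (0 < depth f)%N /\ Vd (depth f) f.
Proof.
by move=> [d d0 Vf]; exact: (@min_nat_in [set d | (0 < d)%N /\ Vd d f] d).
Qed.

Lemma depth_leq d f : (0 < d)%N -> Vd d f -> (depth f <= d)%N.
Proof. by move=> d0 Vf; apply: min_nat_le. Qed.

Lemma VbD_Vd f g : Vb f -> Vb g -> Vd (maxn (depth f) (depth g)) (fun x => f x + g x).
Proof.
move=> /depthP[_ Vf] /depthP[_ Vg].
by apply: VdD; [apply: Vd_leq Vf|apply: Vd_leq Vg]; rewrite ?leq_maxl ?leq_maxr.
Qed.

Lemma depthD f g : Vb f -> Vb g ->
  (depth (fun x => f x + g x)%R <= maxn (depth f) (depth g))%N.
Proof.
move=> Vf Vg; apply: depth_leq; last exact: VbD_Vd.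
by rewrite leq_max; have [->] := depthP Vf.
Qed.

Lemma VbD f g : Vb f -> Vb g -> Vb (fun x => f x + g x).
Proof.
move=> Vf Vg; exists (maxn (depth f) (depth g)); last exact: VbD_Vd.
by rewrite leq_max; have [->] := depthP Vf.
Qed.

Lemma depthZ c f : c != 0 -> depth (fun x => c * f x) = depth f.
Proof.
move=> c0; apply: eq_min_nat => d [d0 Vf]; exists d => //; split => //.
  have := VdZ c^-1 Vf.
  by under eq_fun do rewrite mulKf//.
exact: VdZ.
Qed.

Lemma rk_dim d nu f : Vd d f -> (d <= nu)%N -> (rk nu f <= m)%N.
Proof.
move=> Vf /Vd_leq/(_ Vf) {}Vf; case: hphi => _ _ Sphi.
apply: min_nat_le; exists phi => j.
have [c Hc] := Sphi _ (Vf j); exists c.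
by apply: filterS Hc => y /(_ I).
Qed.

Section RankSums.
Variable h : nat -> nat.
Hypothesis h0 : h 0%N = 0%N.
Hypothesis h_ge : forall x, (x <= h x)%N.
Hypothesis h_homo : {homo h : x y / (x <= y)%N}.
Hypothesis hD : forall x y, (h (x + y) <= 2 * (h x + h y))%N.

(** Taken with h the identity for [compl_N] and with h the square for [compl_C]; the factor 2 in
    [hD] is the one of (x + y)^2 <= 2 (x^2 + y^2). *)
Definition rksum f := (\sum_(1 <= nu < (depth f).+1) h (rk nu f))%N.

Lemma rksum0 f : (\forall x \ae mu, f x = 0) -> rksum f = 0%N.
Proof. by move=> f0; apply: big1 => nu _; rewrite rk_ae0. Qed.

(** By [rk_eq0] no rank of a nonzero function vanishes, so every level contributes at least 1. *)
Lemma depth_le_rksum f : ~ (\forall x \ae mu, f x = 0) -> (depth f <= rksum f)%N.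
Proof.
move=> f0; rewrite /rksum.
apply: (@leq_trans (\sum_(1 <= nu < (depth f).+1) 1)%N).
  by rewrite sum_nat_const_nat muln1 subn1.
apply: leq_sum => nu _; apply: leq_trans (h_ge _); rewrite lt0n.
by apply/eqP => /(rk_eq0 hb).
Qed.

Lemma rksum_eq0 f : Vb f -> rksum f = 0%N -> \forall x \ae mu, f x = 0.
Proof.
move=> /depthP[d0 _] f0; apply: contrapT => /depth_le_rksum.
by rewrite f0 leqn0; case: depth d0.
Qed.

Lemma rksumZ c f : c != 0 -> rksum (fun x => c * f x) = rksum f.
Proof.
by move=> c0; rewrite /rksum depthZ//; apply: eq_bigr => nu _; rewrite rkZ.
Qed.

Lemma rksum_tail f D : Vb f ->
  (\sum_(1 <= nu < D.+1) h (rk nu f) <= rksum f + (D - depth f) * h m)%N.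
Proof.
move=> /depthP[d0 Vf]; rewrite /rksum.
have [Dd|dD] := leqP D (depth f).
  apply: leq_trans (leq_addr _ _).
  by rewrite [leqRHS](@big_cat_nat _ _ _ D.+1)//= leq_addr.
rewrite (@big_cat_nat _ _ _ (depth f).+1)//=; last exact: ltnW.
rewrite leq_add2l -subSS -sum_nat_const_nat big_nat [leqRHS]big_nat.
apply: leq_sum => nu /andP[dn _]; apply: h_homo.
by apply: rk_dim Vf _; exact: ltnW.
Qed.

(** Each level missing to f costs at most h m, since ranks beyond the depth are at most m. There are
    at most depth g such levels, a number bounded by the complexity of g when g is nonzero. *)
Lemma rksum_tail_max f g : Vb f -> Vb g ->
  (\sum_(1 <= nu < (maxn (depth f) (depth g)).+1) h (rk nu f) <=
   rksum f + rksum g * h m)%N.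
Proof.
move=> Vf Vg; apply: leq_trans (rksum_tail _ Vf) _; rewrite leq_add2l leq_mul2r.
have [g0|g0] := pselect (\forall x \ae mu, g x = 0).
  apply/orP; right.
  (* A null function has the smallest depth allowed, hence no level is missing to f. *)
  suff -> : depth g = 1%N.
    by have [d0 _] := depthP Vf; rewrite (maxn_idPl d0) subnn.
  apply/eqP; rewrite eqn_leq; have [-> _] := depthP Vg; rewrite andbT.
  apply: depth_leq => //; apply: Vd_ae; first exact: Vb_measurable Vg.
  by move=> i; exists (cst 0); [case: hS|exact: (ae_tmap hb i g0)].
apply/orP; right; apply: leq_trans (depth_le_rksum g0).
by rewrite leq_subLR geq_max leq_addr leq_addl.
Qed.

(** The factor 2 comes from [hD]; the terms with h m pay for the levels that each summand lacks
    below the larger depth. *)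
Lemma rksumD f g : Vb f -> Vb g ->
  (rksum (fun x => f x + g x)%R <= (2 + 2 * h m) * (rksum f + rksum g))%N.
Proof.
move=> Vf Vg; pose D := maxn (depth f) (depth g).
apply: (@leq_trans (\sum_(1 <= nu < D.+1) h (rk nu (fun x => f x + g x)%R))%N).
  by rewrite [leqRHS](@big_cat_nat _ _ _ (depth (fun x => f x + g x)).+1)//=
      ?leq_addr// ltnS depthD.
apply: (@leq_trans (\sum_(1 <= nu < D.+1) 2 * (h (rk nu f) + h (rk nu g)))%N).
  by apply: leq_sum => nu _; apply: leq_trans (hD _ _); apply: h_homo; exact: rkD.
rewrite -big_distrr/= big_split/=.
have := rksum_tail_max Vf Vg; have := rksum_tail_max Vg Vf.
rewrite maxnC -/D; nia.
Qed.

End RankSums.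

Lemma compl_NE f : Vb f -> compl_N b S f = rksum id f.
Proof.
move=> Vf; rewrite /compl_N /rksum big_nat [RHS]big_nat.
by apply: eq_bigr => nu /andP[_ nud]; rewrite (rankE hb).
Qed.

Lemma compl_CE f : Vb f -> compl_C b S m f =
  (b * rk 1 f + b * (\sum_(2 <= k < (depth f).+1) rk k.-1 f * rk k f) +
   rk (depth f) f * m)%N.
Proof.
move=> Vf; have [d0 _] := depthP Vf.
rewrite /compl_C !(rankE hb)//; congr (_ + _ * _ + _)%N.
rewrite big_nat [RHS]big_nat; apply: eq_bigr => k /andP[k2 kd].
by rewrite !(rankE hb)//; case: k kd {k2} => // k /ltnW.
Qed.

Let sq x := (x ^ 2)%N.

Let sq_ge x : (x <= sq x)%N.
Proof. by case: x => // x; rewrite /sq -mulnn leq_pmulr. Qed.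

(** By [rkS], r_k^2 <= b r_(k-1) r_k; for k = 1 this uses r_0 <= 1. *)
Lemma rksum_sq_le_compl_C f : Vb f -> (rksum sq f <= compl_C b S m f)%N.
Proof.
move=> Vf; have [d0 _] := depthP Vf; rewrite compl_CE// /rksum big_ltn//.
apply: leq_trans (leq_addr _ _); apply: leq_add.
  have := rkS hb 0 f; have := rk0_le1 b f; rewrite /sq; nia.
rewrite big_distrr/= big_nat [leqRHS]big_nat; apply: leq_sum => k /andP[k2 _].
case: k k2 => // k _; rewrite /sq/= mulnA -mulnn leq_mul2r.
by rewrite (rkS hb) orbT.
Qed.

(** The first core gives b, the products r_(k-1) r_k <= r_(k-1)^2 + r_k^2 give 2 b as each rank
    occurs in at most two of them, and the last core gives m. *)
Lemma compl_C_le_rksum_sq f : Vb f -> (compl_C b S m f <= (3 * b + m) * rksum sq f)%N.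
Proof.
move=> Vf; have [d0 _] := depthP Vf; rewrite compl_CE//.
have h1 : (rk 1 f <= rksum sq f)%N.
  rewrite /rksum big_ltn//; exact: leq_trans (sq_ge _) (leq_addr _ _).
have hd : (rk (depth f) f <= rksum sq f)%N.
  rewrite /rksum big_nat_recr//=; exact: leq_trans (sq_ge _) (leq_addl _ _).
have hs : (\sum_(2 <= k < (depth f).+1) rk k.-1 f * rk k f <= 2 * rksum sq f)%N.
  apply: (@leq_trans (\sum_(2 <= k < (depth f).+1) (sq (rk k.-1 f) + sq (rk k f)))%N).
    by apply: leq_sum => k _; rewrite /sq; nia.
  rewrite big_split/= mul2n -addnn leq_add//.
    rewrite big_add1/= /rksum [leqRHS]big_nat_recr//= leq_addr//.
  by rewrite /rksum [leqRHS]big_ltn// leq_addl.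
nia.
Qed.

Lemma rksum_sq_le f : (rksum sq f <= rksum id f ^ 2)%N.
Proof.
rewrite /rksum; elim: (depth f) => [|d IH]; first by rewrite !big_geq.
rewrite !(@big_nat_recr _ _ _ d.+1 1)// sqrnD; apply: leq_trans (leq_addr _ _).
by rewrite leq_add2r.
Qed.

End DyadicSpaces.

(** * Counting nonzero entries of matrices *)

Section NonzeroEntries.
Context {R : realType}.

Lemma l0_mxE s t (M : 'M[R]_(s, t)) :
  l0_mx M = (\sum_i \sum_j (M i j != 0)%R)%N.
Proof.
rewrite /l0_mx pair_bigA/= -sum1_card big_mkcond/=.
by apply: eq_bigr => ij _; rewrite inE; case: eqP.
Qed.

Lemma l0_mx0 s t : l0_mx (0 : 'M[R]_(s, t)) = 0%N.
Proof. by rewrite l0_mxE big1// => i _; rewrite big1// => j _; rewrite mxE eqxx. Qed.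

Lemma l0_mx_eq0 s t (M : 'M[R]_(s, t)) i j : l0_mx M = 0%N -> M i j = 0.
Proof.
rewrite l0_mxE => /eqP; rewrite sum_nat_eq0 => /forallP/(_ i)/=.
by rewrite sum_nat_eq0 => /forallP/(_ j)/=; case: (M i j =P 0).
Qed.

Lemma l0_mx_le s t (M : 'M[R]_(s, t)) : (l0_mx M <= s * t)%N.
Proof. by rewrite /l0_mx (leq_trans (max_card _))// card_prod !card_ord. Qed.

Lemma l0_mx_row s t u (A : 'M[R]_(s, t)) (B : 'M[R]_(s, u)) :
  l0_mx (row_mx A B) = (l0_mx A + l0_mx B)%N.
Proof.
rewrite !l0_mxE -big_split/=; apply: eq_bigr => i _.
rewrite big_split_ord/=; congr (_ + _)%N; apply: eq_bigr => j _.
  by rewrite row_mxEl.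
by rewrite row_mxEr.
Qed.

Lemma l0_mx_col s t u (A : 'M[R]_(s, t)) (B : 'M[R]_(u, t)) :
  l0_mx (col_mx A B) = (l0_mx A + l0_mx B)%N.
Proof.
rewrite !l0_mxE big_split_ord/=; congr (_ + _)%N; apply: eq_bigr => i _;
  apply: eq_bigr => j _; [by rewrite col_mxEu|by rewrite col_mxEd].
Qed.

Lemma l0_mx_diag s t s' t' (A : 'M[R]_(s, t)) (B : 'M[R]_(s', t')) :
  l0_mx (block_mx A 0 0 B) = (l0_mx A + l0_mx B)%N.
Proof. by rewrite /block_mx l0_mx_col !l0_mx_row !l0_mx0 addn0. Qed.

Lemma l0_mxZ s t (c : R) (A : 'M[R]_(s, t)) : (l0_mx (c *: A) <= l0_mx A)%N.
Proof.
rewrite !l0_mxE; apply: leq_sum => i _; apply: leq_sum => j _.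
by rewrite mxE mulf_eq0; case: eqP; rewrite ?orbT ?leq_b1// => ->; rewrite ?orbT.
Qed.

(** A nonzero entry in row i of the product requires a nonzero entry in row i of A, and that row of
    the product has u entries. *)
Lemma l0_mxM s t u (A : 'M[R]_(s, t)) (B : 'M[R]_(t, u)) :
  (l0_mx (A *m B) <= u * l0_mx A)%N.
Proof.
rewrite !l0_mxE big_distrr/=; apply: leq_sum => i _.
rewrite -[u in (_ <= u * _)%N]card_ord -sum_nat_const; apply: leq_sum => j _.
have [_|] := eqVneq ((A *m B) i j) 0; first by [].
rewrite mxE => nz; have [k _ Ak] : exists2 k, true & A i k * B k j != 0.
  apply/exists_inP; apply: contraNT nz; rewrite negb_exists_in => /forallP H.
  by rewrite big1// => k _; apply/eqP; have := H k; rewrite /= negbK.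
rewrite (bigD1 k)//=; move: Ak; rewrite mulf_eq0 negb_or => /andP[-> _].
by rewrite leq_addr.
Qed.

Lemma l0_mx1 s : l0_mx (1%:M : 'M[R]_s) = s.
Proof.
rewrite l0_mxE -[RHS]card_ord -sum1_card; apply: eq_bigr => i _.
rewrite (bigD1 i)//= mxE eqxx oner_eq0 big1// => j /negbTE ji.
by rewrite mxE (eq_sym i j) ji eqxx.
Qed.

End NonzeroEntries.

Lemma ae01 (R : realType) : \forall y \ae mu01 R, y \in `[0%R, 1%R[.
Proof.
by apply/mu01_aeP; apply: negligibleS (negligible_set0 (@lebesgue_measure R)) => x /= [].
Qed.

(** * Networks as successive subdivisions of families of functions *)

Section Chains.
Context {R : realType} (b : nat) (hb : (0 < b)%N) (p : \bar R).
Local Notation mu := (mu01 R).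
Local Notation rk := (rk b).
Variables (S : set (R -> R)) (hS : Lp_subspace p S).
Variables (m : nat) (phi : 'I_m -> R -> R) (hphi : Lp_basis S phi).
Hypothesis hdil : dilation_closed b S.
Local Notation Vd := (Vd b S).
Local Notation Vb := (Vb b S).
Local Notation depth := (depth b S).
Implicit Types f g : R -> R.

(* [chain d F c]: by [d] successive subdivisions, the functions [F k] are
   jointly represented by a tensor network with at most [c] nonzero entries,
   the first index of which is [k]. *)
Fixpoint chain (d : nat) : forall s, ('I_s -> R -> R) -> nat -> Prop :=
  match d with
  | 0 => fun s F c => exists2 W : 'M[R]_(s, m), (l0_mx W <= c)%N &
      forall k, \forall x \ae mu, F k x = \sum_l W k l * phi l x
  | d'.+1 => fun s F c => exists r (A : 'I_b -> 'M[R]_(s, r)) (G : 'I_r -> R -> R) c',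
      [/\ (0 < r)%N, (\sum_i l0_mx (A i) + c' <= c)%N,
          forall k i, \forall y \ae mu, F k (cell i y) = \sum_l A i k l * G l y
        & chain d' G c']
  end.

Lemma chain_ae d s (F F' : 'I_s -> R -> R) c :
  (forall k, \forall x \ae mu, F k x = F' k x) -> chain d F c -> chain d F' c.
Proof.
case: d => [|d] FF' /=.
  by move=> [W Wc H]; exists W => // k; apply: filterS2 (FF' k) (H k) => x ->.
move=> [r [A [G [e [r0 Ae HA HG]]]]]; exists r, A, G, e; split => // k i.
by apply: filterS2 (ae_cell hb i (FF' k)) (HA k i) => x ->.
Qed.

(** The scalar is absorbed by the matrices of the first level alone, so the count of nonzero entries
    cannot grow, even for a = 0. *)
Lemma chainZ d s (F : 'I_s -> R -> R) a c :
  chain d F c -> chain d (fun k x => a * F k x) c.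
Proof.
case: d => [|d] /=.
  move=> [W Wc H]; exists (a *: W); first exact: leq_trans (l0_mxZ _ _) Wc.
  move=> k; apply: filterS (H k) => x ->; rewrite big_distrr/=.
  by apply: eq_bigr => l _; rewrite mxE mulrA.
move=> [r [A [G [e [r0 Ae HA HG]]]]]; exists r, (fun i => a *: A i), G, e.
split => //.
  by apply: leq_trans Ae; rewrite leq_add2r; apply: leq_sum => i _; exact: l0_mxZ.
move=> k i; apply: filterS (HA k i) => x ->; rewrite big_distrr/=.
by apply: eq_bigr => l _; rewrite mxE mulrA.
Qed.

Definition family_cat s t (F : 'I_s -> R -> R) (G : 'I_t -> R -> R) (k : 'I_(s + t)) :=
  match fintype.split k with inl l => F l | inr l => G l end.

Lemma family_catl s t (F : 'I_s -> R -> R) (G : 'I_t -> R -> R) k :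
  family_cat F G (lshift t k) = F k.
Proof. by rewrite /family_cat -[lshift t k]/(unsplit (inl k)) unsplitK. Qed.

Lemma family_catr s t (F : 'I_s -> R -> R) (G : 'I_t -> R -> R) k :
  family_cat F G (rshift s k) = G k.
Proof. by rewrite /family_cat -[rshift s k]/(unsplit (inr k)) unsplitK. Qed.

(** At every level the matrices are put in block diagonal form; the zero blocks are free, so the
    counts add up. *)
Lemma chain_cat d s t (F : 'I_s -> R -> R) (G : 'I_t -> R -> R) c c' :
  chain d F c -> chain d G c' -> chain d (family_cat F G) (c + c').
Proof.
elim: d s t F G c c' => [|d IH] s t F G c c' /=.
  move=> [W Wc H] [W' Wc' H']; exists (col_mx W W').
    by rewrite l0_mx_col leq_add.
  move=> k; case: (split_ordP k) => j ->.
    by rewrite family_catl; apply: filterS (H j) => x ->; under [RHS]eq_bigr do rewrite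
        col_mxEu.
  by rewrite family_catr; apply: filterS (H' j) => x ->; under [RHS]eq_bigr do rewrite
      col_mxEd.
move=> [r [A [F1 [e [r0 Ae HA HF]]]]] [r' [A' [G1 [e' [r0' Ae' HA' HG]]]]].
exists (r + r')%N, (fun i => block_mx (A i) 0 0 (A' i)), (family_cat F1 G1), (e + e')%N.
split; [by rewrite addn_gt0 r0| | |exact: IH].
  under eq_bigr do rewrite l0_mx_diag.
  by rewrite big_split/= addnACA leq_add.
move=> k i; case: (split_ordP k) => j ->.
- rewrite family_catl; apply: filterS (HA j i) => x ->.
  rewrite big_split_ord/= [X in _ = _ + X]big1 ?addr0.
    by apply: eq_bigr => l _; rewrite block_mxEul family_catl.
  by move=> l _; rewrite block_mxEur mxE mul0r.
- rewrite family_catr; apply: filterS (HA' j i) => x ->.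
  rewrite big_split_ord/= [X in _ = X + _]big1 ?add0r.
    by apply: eq_bigr => l _; rewrite block_mxEdr family_catr.
  by move=> l _; rewrite block_mxEdl mxE mul0r.
Qed.

(** At the first level the two rows are juxtaposed instead of stacked, which performs the addition;
    the levels below are handled by [chain_cat]. *)
Lemma chainD d f g c c' : chain d.+1 (fun _ : 'I_1 => f) c ->
  chain d.+1 (fun _ : 'I_1 => g) c' ->
  chain d.+1 (fun _ : 'I_1 => fun x => f x + g x) (c + c').
Proof.
move=> [r [A [F1 [e [r0 Ae HA HF]]]]] [r' [A' [G1 [e' [r0' Ae' HA' HG]]]]].
exists (r + r')%N, (fun i => row_mx (A i) (A' i)), (family_cat F1 G1), (e + e')%N.
split; [by rewrite addn_gt0 r0| | |exact: chain_cat].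
  under eq_bigr do rewrite l0_mx_row.
  by rewrite big_split/= addnACA leq_add.
move=> k i; apply: filterS2 (HA k i) (HA' k i) => x -> ->.
rewrite big_split_ord/=; congr (_ + _); apply: eq_bigr => l _.
  by rewrite row_mxEl family_catl.
by rewrite row_mxEr family_catr.
Qed.

Lemma phi_cell : exists a : 'I_b -> 'M[R]_m, forall k i, \forall y \ae mu,
  phi k (cell i y) = \sum_l a i k l * phi l y.
Proof.
case: hphi => Sphi _ span.
have /choice[a Ha] : forall ki : 'I_m * 'I_b, exists c : 'I_m -> R, \forall y \ae mu,
    phi ki.1 (cell ki.2 y) = \sum_l c l * phi l y.
  move=> [k i]; have [c Hc] := span _ (hdil (Sphi k) i).
  by exists c; apply: filterS Hc => y /(_ I).
exists (fun i => \matrix_(k, l) a (k, i) l) => k i; apply: filterS (Ha (k, i)) => y /= ->.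
by apply: eq_bigr => l _; rewrite mxE.
Qed.

(** Each level carries the b dilation matrices of [phi], of size m x m, and the last matrix is the
    identity. Widths being positive, m has to be so. *)
Lemma chain_phi e : (0 < m)%N -> chain e phi (e * (b * (m * m)) + m).
Proof.
move=> m0; have [a Ha] := phi_cell; elim: e => [|e IH] /=.
  exists 1%:M; first by rewrite l0_mx1.
  move=> k; apply: aeW => x; rewrite (bigD1 k)//= mxE eqxx mul1r big1 ?addr0//.
  by move=> l /negbTE lk; rewrite mxE eq_sym lk mul0r.
exists m, a, phi, (e * (b * (m * m)) + m)%N; split => //.
rewrite addnA leq_add2r mulSn leq_add2r.
apply: (@leq_trans (\sum_(i < b) m * m)%N).
  by apply: leq_sum => i _; exact: l0_mx_le.
by rewrite sum_nat_const card_ord.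
Qed.

(** The last matrix W is replaced by the b products W a_i, with at most b m times as many nonzero
    entries, and the e other new levels come from [chain_phi]. The successor keeps the factor at
    least 1, so that it also covers the matrices left unchanged. *)
Lemma chain_extend d e s (F : 'I_s -> R -> R) c : (0 < m)%N -> chain d F c ->
  chain (d + e.+1) F ((b * m).+1 * c + (e * (b * (m * m)) + m)).
Proof.
move=> m0; elim: d s F c => [|d IH] s F c.
  move=> [W Wc H]; rewrite add0n /=; have [a Ha] := phi_cell.
  exists m, (fun i => W *m a i), phi, (e * (b * (m * m)) + m)%N; split => //.
  - rewrite leq_add2r; apply: (@leq_trans (\sum_(i < b) (m * l0_mx W))%N).
      by apply: leq_sum => i _; exact: l0_mxM.
    rewrite sum_nat_const card_ord mulnA; apply: (@leq_trans (b * m * c)%N).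
      by rewrite leq_mul2l Wc orbT.
    by rewrite mulSn leq_addl.
  - move=> k i; have Ha' := ae_forall (fun k => Ha k i).
    apply: filterS2 (ae_cell hb i (H k)) Ha' => y -> Hy.
    under [LHS]eq_bigr do rewrite Hy big_distrr/=.
    rewrite exchange_big/=; apply: eq_bigr => l _.
    by rewrite mxE big_distrl/=; apply: eq_bigr => l' _; rewrite mulrA.
  - exact: chain_phi.
move=> [r [A [G [c' [r0 Ae HA /IH HG]]]]]; rewrite addSn /=.
exists r, A, G, ((b * m).+1 * c' + (e * (b * (m * m)) + m))%N; split => //.
rewrite addnA leq_add2r.
apply: (@leq_trans ((b * m).+1 * (\sum_i l0_mx (A i) + c'))%N).
  by rewrite mulnDr leq_add2r leq_pmull.
by rewrite leq_mul2l Ae orbT.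
Qed.

(** A nonzero function is sent by some nonzero entry to a function that is again nonzero. This
    happens at each of the d levels and in the last matrix, whence d + 1 <= c. *)
Lemma chain_depth d s (F : 'I_s -> R -> R) c k : chain d F c ->
  ~ (\forall x \ae mu, F k x = 0) -> (d < c)%N /\ (0 < m)%N.
Proof.
elim: d s F c k => [|d IH] s F c k /=.
  move=> [W Wc H] F0; split.
    apply: leq_trans Wc; rewrite lt0n; apply/eqP => W0; apply: F0.
    apply: filterS (H k) => x ->; rewrite big1// => l _.
    by rewrite (l0_mx_eq0 _ _ W0) mul0r.
  rewrite lt0n; apply/eqP => m0; apply: F0; apply: filterS (H k) => x ->.
  by rewrite big1// => -[l hl]; exfalso; move: hl; rewrite m0.
move=> [r [A [G [e [r0 Ae HA HG]]]]] F0.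
have [i [l [Ail Gl]]] : exists i l, A i k l != 0 /\ ~ (\forall x \ae mu, G l x = 0).
  apply: contrapT => H; apply: F0; apply: (ae_cells hb) => i.
  have Hl l : \forall y \ae mu, A i k l * G l y = 0.
    have [->|Ail] := eqVneq (A i k l) 0; first by apply: aeW => y; rewrite mul0r.
    have : \forall x \ae mu, G l x = 0.
      by apply: contrapT => Gl; apply: H; exists i, l.
    by apply: filterS => x ->; rewrite mulr0.
  by apply: filterS2 (HA k i) (ae_forall Hl) => y -> Hy; rewrite big1.
have [de m0] := IH _ _ _ _ HG Gl; split=> //; apply: leq_trans Ae.
rewrite (bigD1 i)//=; have : l0_mx (A i) != 0%N.
  by apply: contraNneq Ail => /l0_mx_eq0 ->.
lia.
Qed.

(** The width r is not controlled by the number of nonzero entries, but the number of nonzero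
    columns is. Columns that vanish for all digits contribute to no section, so [rho] counts only
    the others. *)
Lemma chain_rk d s (F : 'I_s -> R -> R) c : chain d F c ->
  exists rho : nat -> nat, (\sum_(1 <= nu < d.+1) rho nu <= c)%N /\
    forall nu, (0 < nu <= d)%N -> exists w : 'I_(rho nu) -> R -> R,
      forall k (j : {ffun 'I_nu -> 'I_b}), aespan w (fun y => F k (tmap j y)).
Proof.
elim: d s F c => [|d IH] s F c /=.
  move=> _; exists (fun=> 0%N); split; first by rewrite big_geq.
  by move=> [].
move=> [r [A [G [e [r0 Ae HA /IH[rho [Hrho Hw]]]]]]].
pose active := [set l : 'I_r | [exists i, exists k, A i k l != 0]]%SET.
(* Level nu + 2 is level nu + 1 of the tail; the value at 0 lies outside the range of summation. *)
exists (fun nu => if nu is nu'.+2 then rho nu'.+1 else #|active|); split.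
  rewrite big_ltn// big_add1/=; apply: leq_trans Ae; apply: leq_add; last first.
    apply: leq_trans Hrho; rewrite big_nat [leqRHS]big_nat.
    by apply: leq_sum => -[|nu].
  apply: (@leq_trans (\sum_l \sum_i \sum_k (A i k l != 0)%R)%N).
    rewrite -sum1_card big_mkcond/=; apply: leq_sum => l _.
    case: ifP => //; rewrite inE => /existsP[i /existsP[k Aikl]].
    by rewrite (bigD1 i)//= (bigD1 k)//= Aikl.
  rewrite exchange_big/=; apply: leq_sum => i _; rewrite l0_mxE.
  by rewrite exchange_big/=.
move=> [|[|nu]]//= nud.
  exists (fun k => G (enum_val k)) => k j; set i := j ord0.
  exists (fun l => A i k (enum_val l)); apply: filterS (HA k i) => y Hy.
  rewrite tmapS tmap0 Hy -/i.
  rewrite (bigID [in active])/= [X in _ + X]big1 ?addr0.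
    rewrite big_enum_val/=; apply: eq_bigr => l _ //.
  move=> l; rewrite inE => /existsPn/(_ i)/existsPn/(_ k)/negPn/eqP ->.
  by rewrite mul0r.
have [w Hw'] := Hw nu.+1 nud; exists w => k j.
pose j' := [ffun l => j (lift ord0 l)].
have := ae_tmap hb j' (HA k (j ord0)) => Hy.
apply: aespan_ae (aespan_sum (A (j ord0) k) (fun l => Hw' l j')).
by apply: filterS Hy => y Hy; rewrite -Hy tmapS.
Qed.

Lemma S_sum (I : finType) (c : I -> R) (g : I -> R -> R) :
  (forall i, S (g i)) -> S (fun x => \sum_i c i * g i x).
Proof.
move=> Sg; case: hS => _ S0 Slin _.
elim: (index_enum I) => [|i s IH].
  by under eq_fun do rewrite big_nil.
by under eq_fun do rewrite big_cons; exact: Slin.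
Qed.

Lemma chain_S d s (F : 'I_s -> R -> R) c k (j : {ffun 'I_d -> 'I_b}) : chain d F c ->
  exists2 g, S g & \forall y \ae mu, F k (tmap j y) = g y.
Proof.
elim: d s F c k j => [|d IH] s F c k j /=.
  move=> [W Wc H]; exists (fun x => \sum_l W k l * phi l x).
    by apply: S_sum => l; case: hphi.
  by apply: filterS (H k) => x; rewrite tmap0.
move=> [r [A [G [e [r0 Ae HA HG]]]]].
pose j' := [ffun l => j (lift ord0 l)].
have /choice[g Hg] : forall l, exists g, S g /\ \forall y \ae mu, G l (tmap j' y) = g y.
  by move=> l; have [g Sg gG] := IH _ _ _ l j' HG; exists g.
exists (fun y => \sum_l A (j ord0) k l * g l y); first by apply: S_sum => l; case: (Hg l).
have Hg' := ae_forall (fun l => (Hg l).2).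
apply: filterS2 (ae_tmap hb j' (HA k (j ord0))) Hg' => y Hy Hy'.
by rewrite tmapS Hy; apply: eq_bigr => l _; rewrite Hy'.
Qed.

Lemma chain_Vd d f c : measurable_fun setT f -> chain d (fun _ : 'I_1 => f) c -> Vd d f.
Proof.
move=> mf H; apply: (Vd_ae hS) => // i.
exact: (chain_S ord0 i H).
Qed.

(** The ranks vanish here while widths must be positive: width 1 with zero matrices costs
    nothing. *)
Lemma chain0 f : (\forall x \ae mu, f x = 0) -> chain 1 (fun _ : 'I_1 => f) 0.
Proof.
move=> f0; exists 1%N, (fun=> 0), (fun=> cst 0), 0%N; split => //.
- by rewrite addn0 big1// => i _; rewrite l0_mx0.
- move=> k i; apply: filterS (ae_cell hb i f0) => x ->.
  by rewrite big1// => l _; rewrite mulr0.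
- exists 0; first by rewrite l0_mx0.
  by move=> k; apply: aeW => x; rewrite big1// => l _; rewrite mxE mul0r.
Qed.

(** The restriction of a basis section of level nu to a cell is a section of level nu + 1, hence
    expands in the basis chosen there; this gives b matrices of size r_nu x r_(nu+1). At the last
    level the sections lie in S and expand in [phi]. *)
Lemma chain_basis f (bas : forall nu, 'I_(rk nu f) -> {ffun 'I_nu -> 'I_b}) :
  (forall nu, exists L : {ffun 'I_nu -> 'I_b} -> 'I_(rk nu f) -> R,
    forall j, \forall y \ae mu,
      f (tmap j y) = \sum_(l < rk nu f) L j l * f (tmap (bas nu l) y)) ->
  ~ (\forall x \ae mu, f x = 0) ->
  forall e nu, Vd (nu + e) f -> chain e (fun l y => f (tmap (bas nu l) y))
    (\sum_(nu <= k < nu + e) (b * (rk k f * rk k.+1 f)) + rk (nu + e) f * m).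
Proof.
move=> HL0 f0.
pose L nu := sval (cid (HL0 nu)); have HL nu := svalP (cid (HL0 nu)).
elim=> [|e IH] nu Vf /=.
  case: hphi => _ _ span.
  have /choice[c Hc] : forall l, exists c : 'I_m -> R,
      \forall y \ae mu, f (tmap (bas nu l) y) = \sum_k c k * phi k y.
    move=> l; move: Vf; rewrite addn0 => /(_ (bas nu l))/span[c Hc].
    by exists c; apply: filterS Hc => y /(_ I).
  exists (\matrix_(k, l) c k l).
    by rewrite big_geq ?addn0// add0n l0_mx_le.
  move=> k; apply: filterS (Hc k) => y ->.
  by apply: eq_bigr => l _; rewrite mxE.
pose snoc k (i : 'I_b) : {ffun 'I_(nu + 1) -> 'I_b} := dcat (bas nu k) [ffun=> i].
exists (rk (nu + 1) f), (fun i => \matrix_(k, l) L (nu + 1)%N (snoc k i) l),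
  (fun l y => f (tmap (bas (nu + 1)%N l) y)),
  (\sum_(nu.+1 <= k < nu + e.+1) (b * (rk k f * rk k.+1 f)) + rk (nu + e.+1) f * m)%N.
split.
- by rewrite lt0n; apply/eqP => /(rk_eq0 hb).
- rewrite addnA leq_add2r [leqRHS]big_ltn; last by rewrite addnS ltnS leq_addr.
  rewrite leq_add2r; apply: (@leq_trans (\sum_(i < b) (rk nu f * rk (nu + 1) f))%N).
    by apply: leq_sum => i _; exact: l0_mx_le.
  by rewrite sum_nat_const card_ord addn1.
- move=> k i; apply: filterS (HL (nu + 1)%N (snoc k i)) => y.
  rewrite /snoc tmap_dcat tmapS tmap0 ffunE => ->.
  by apply: eq_bigr => l _; rewrite mxE.
- by have := IH (nu + 1)%N; rewrite -addnA addn1 add1n; apply.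
Qed.

(** The first level is treated by hand with the single row f, at a cost of b r_1; [chain_basis]
    takes over from level 1. *)
Lemma chain_rank f : Vb f -> ~ (\forall x \ae mu, f x = 0) ->
  chain (depth f) (fun _ : 'I_1 => f) (compl_C b S m f).
Proof.
move=> Vf f0; rewrite (compl_CE hb)//.
have [] := depthP Vf; case: (depth f) => // d _ Vdf.
pose bas nu := sval (cid (rk_basis b nu f)).
have Hbas nu := svalP (cid (rk_basis b nu f)).
have [L HL] := Hbas 1%N.
exists (rk 1 f), (fun i => \matrix_(k, l) L [ffun=> i] l), (fun l y => f (tmap (bas 1%N
    l) y)).
exists (\sum_(1 <= k < 1 + d) (b * (rk k f * rk k.+1 f)) + rk (1 + d) f * m)%N; split.
- by rewrite lt0n; apply/eqP => /(rk_eq0 hb).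
- rewrite addnA; apply: leq_add => //; apply: leq_add.
    apply: (@leq_trans (\sum_(i < b) (1 * rk 1 f))%N).
      by apply: leq_sum => i _; exact: l0_mx_le.
    by rewrite sum_nat_const card_ord mul1n.
  rewrite big_distrr/= [leqRHS]big_add1/= add1n.
  by apply: leq_sum => k _; rewrite mulnA.
- move=> k i; apply: filterS (HL [ffun=> i]) => y.
  rewrite tmapS tmap0 ffunE => ->.
  by apply: eq_bigr => l _; rewrite mxE.
- exact: chain_basis.
Qed.

End Chains.

(** * Paths of indices through a network *)

(* Ranks are taken of the form [r \o val] with [r : nat -> nat], so that the
   types of the shifted cores are convertible to the expected ones. *)
Section DependentPaths.
Variables (n : nat) (r : nat -> nat).

Definition path_cons (k0 : 'I_(r 0)) (k : {dffun forall nu : 'I_n, 'I_(r nu.+1)}) :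
    {dffun forall nu : 'I_n.+1, 'I_(r nu)} :=
  [ffun nu : 'I_n.+1 => match nu as nu return 'I_(r nu) with
    | Ordinal j h => (match j as j return (j < n.+1)%N -> 'I_(r j) with
        | 0 => fun=> k0
        | j'.+1 => fun h => k (@Ordinal n j' h)
        end) h
    end].

Definition path_tail (k : {dffun forall nu : 'I_n.+1, 'I_(r nu)}) :
    {dffun forall nu : 'I_n, 'I_(r nu.+1)} :=
  [ffun nu : 'I_n => k (lift ord0 nu) : 'I_(r nu.+1)].

(** The two values live in types depending on i and j, so they are compared as natural numbers. *)
Lemma path_val (s : nat) (r' : nat -> nat) (k : {dffun forall nu : 'I_s, 'I_(r' nu)})
    (i j : 'I_s) :
  i = j -> k i = k j :> nat.
Proof. by move->. Qed.

Lemma path_cons0 k0 k : path_cons k0 k ord0 = k0.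
Proof. by rewrite /path_cons ffunE. Qed.

Lemma path_consS k0 k (nu : 'I_n) (o : 'I_n.+1) : o = lift ord0 nu ->
  path_cons k0 k o = k nu :> nat.
Proof.
move=> ->; rewrite /path_cons ffunE /=.
by apply: (@path_val n (fun j => r j.+1)); apply: val_inj.
Qed.

Lemma path_consK k0 k : path_tail (path_cons k0 k) = k.
Proof. by apply/ffunP => nu; apply: val_inj; rewrite ffunE; exact: path_consS. Qed.

Lemma path_tailK (k : {dffun forall nu : 'I_n.+1, 'I_(r nu)}) :
  path_cons (k ord0) (path_tail k) = k.
Proof.
apply/ffunP => nu; apply: val_inj; case: nu => -[|j] h /=.
  rewrite /path_cons ffunE /=; apply: path_val; exact: val_inj.
have h' : (j < n)%N by [].
apply: etrans (@path_consS _ _ (Ordinal h') _ _) _; first exact: val_inj.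
by rewrite ffunE; apply: path_val; exact: val_inj.
Qed.

Lemma big_path (V : nmodType) (F : {dffun forall nu : 'I_n.+1, 'I_(r nu)} -> V) :
  \sum_k F k = \sum_(k0 : 'I_(r 0)) \sum_(k : {dffun forall nu : 'I_n, 'I_(r nu.+1)}) F
      (path_cons k0 k).
Proof.
rewrite pair_bigA/= (reindex (fun q => path_cons q.1 q.2))//=.
exists (fun k : {dffun forall nu : 'I_n.+1, 'I_(r nu)} =>
  (k ord0, path_tail k)) => [[k0 k] _|k _] /=.
  by rewrite path_cons0 path_consK.
exact: path_tailK.
Qed.

End DependentPaths.

(** * Translation between tensor networks and chains *)

Section NetworkChains.
Context {R : realType} (b : nat) (hb : (0 < b)%N).
Local Notation mu := (mu01 R).
Variables (m : nat) (phi : 'I_m -> R -> R).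
Local Notation chain := (@chain R b m phi).

(** Contraction of the cores v_2, ..., v_(d+1), started at the index k and performed one level at a
    time, as in [chain]; [tn_eval] sums over all paths at once. *)
Fixpoint tn_tail (n : nat) : forall (r : nat -> nat)
    (mid : forall nu : nat, 'I_b -> 'M[R]_(r nu, r nu.+1)) (last : 'M[R]_(r n, m))
    (k : 'I_(r 0)) (i : {ffun 'I_n -> 'I_b}) (y : R), R :=
  match n with
  | 0 => fun r mid last k i y => \sum_l last k l * phi l y
  | n'.+1 => fun r mid last k i y => \sum_(k1 < r 1)
      mid 0 (i ord0) k k1 *
      tn_tail (r := fun j => r j.+1) (fun nu => mid nu.+1) last k1
        [ffun l : 'I_n' => i (lift ord0 l)] y
  end.

Lemma tmap01 n (i : {ffun 'I_n -> 'I_b}) (y : R) :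
  y \in `[0%R, 1%R[ -> tmap i y \in `[0%R, 1%R[.
Proof.
by elim: n i => [|n IH] i y01; rewrite ?tmap0// tmapS cell01// IH.
Qed.

Lemma sum_paths n (r : nat -> nat) (mid : forall nu : nat, 'I_b -> 'M[R]_(r nu, r nu.+1))
    (last : 'M[R]_(r n, m)) (u : 'I_(r 0) -> R) (i : {ffun 'I_n -> 'I_b}) y :
  \sum_(k : {dffun forall nu : 'I_n.+1, 'I_(r nu)})
    u (k ord0) * (\prod_(nu < n) mid nu (i nu) (k (widen_ord (leqnSn n) nu)) (k (lift
        ord0 nu))) *
    (\sum_l last (k ord_max) l * phi l y) =
  \sum_k u k * tn_tail mid last k i y.
Proof.
elim: n r mid last u i => [|n IH] r mid last u i.
  rewrite big_path/=; apply: eq_bigr => k0 _.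
  have E (k : {dffun forall nu : 'I_0, 'I_(r nu.+1)}) : path_cons k0 k ord_max = k0.
    apply: val_inj => /=; rewrite -[in RHS](path_cons0 k0 k).
    by apply: path_val; exact: val_inj.
  under eq_bigr => k _ do rewrite path_cons0 big_ord0 mulr1 E.
  rewrite sumr_const; set N := #|_|; suff -> : N = 1%N by [].
  have k1 : {dffun forall nu : 'I_0, 'I_(r nu.+1)} by apply: finfun => -[].
  apply/eqP/fintype1P; exists k1 => k; apply/ffunP => -[] //.
rewrite big_path/=; apply: eq_bigr => k0 _.
(* The row of the first middle core selected by k0 becomes the new vector [u] of the induction. *)
rewrite -(IH (fun j => r j.+1) (fun nu => mid nu.+1) last (fun k1 => mid 0%N (i ord0)
    k0 k1)).
rewrite big_distrr/=; apply: eq_bigr => k _.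
rewrite path_cons0 -!mulrA; congr (_ * _).
rewrite big_ord_recl/= -!mulrA; congr (_ * (_ * _)).
- congr (mid 0%N _ _ _); apply: val_inj => /=.
    rewrite -[in RHS](path_cons0 k0 k); apply: path_val; exact: val_inj.
  exact: (@path_consS _ _ k0 k (@ord0 n) _ erefl).
- apply: eq_bigr => nu _.
  congr (mid nu.+1 _ _ _); first (by rewrite ffunE); apply: val_inj => /=.
    by apply: (@path_consS _ _ k0 k (widen_ord (leqnSn n) nu)); exact: val_inj.
  exact: (@path_consS _ _ k0 k (lift ord0 nu) _ erefl).
- apply: eq_bigr => l _; congr (last _ _ * _).
  by apply: val_inj => /=; apply: (@path_consS _ _ k0 k ord_max); exact: val_inj.
Qed.

(** Functions are rebuilt from the tensor by reading digits: on [0, 1) [digit] and [digit_frac]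
    invert the cell maps, so the identity holds pointwise there. *)
Lemma tn_tail_chain n (r : nat -> nat) (mid : forall nu : nat, 'I_b -> 'M[R]_(r nu, r
    nu.+1))
    (last : 'M[R]_(r n, m)) : (forall nu, (nu <= n)%N -> (0 < r nu)%N) ->
  exists F : 'I_(r 0) -> R -> R,
    chain n F (\sum_(nu < n) \sum_i l0_mx (mid nu i) + l0_mx last) /\
    forall k i y, y \in `[0%R, 1%R[ -> F k (tmap i y) = tn_tail mid last k i y.
Proof.
elim: n r mid last => [|n IH] r mid last r0.
  exists (fun k y => \sum_l last k l * phi l y); split.
    by exists last => //; [rewrite big_ord0|move=> k; exact: aeW].
  by move=> k i y _; rewrite tmap0.
have [G [cG HG]] := IH (fun j => r j.+1) (fun nu => mid nu.+1) last (fun nu => r0 nu.+1).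
exists (fun k x => \sum_k1 mid 0%N (digit hb x) k k1 * G k1 (digit_frac hb x)); split.
  exists (r 1%N), (mid 0%N), G, (\sum_(nu < n) \sum_i l0_mx (mid nu.+1 i) + l0_mx last)%N.
  split => //; [exact: r0|by rewrite big_ord_recl addnA|].
  move=> k i; apply: filterS (ae01 R) => y y01.
  rewrite /digit_frac digit_cell//; apply: eq_bigr => l _.
  by rewrite (cellK hb).
move=> k i y y01; rewrite tmapS /=.
set j := [ffun l => _]; have j01 := tmap01 j y01.
rewrite /digit_frac digit_cell//; apply: eq_bigr => l _.
by rewrite (cellK hb) HG.
Qed.

Lemma chain_of_tn n (r : 'I_n.+1 -> nat) (v : tn_params R b m r) f :
  (forall nu, (0 < r nu)%N) -> tn_realizes v phi f ->
  chain n.+1 (fun _ : 'I_1 => f) (tn_l0 v).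
Proof.
(* Extending the widths to all natural numbers makes the types of shifted cores convertible. *)
have [r0 Er] : exists r0 : nat -> nat, r = fun nu : 'I_n.+1 => r0 nu.
  by exists (fun j => r (inord j)); apply/funext => nu; rewrite inord_val.
rewrite {}Er in v *; move: v => [first cmid last] rpos Hf.
(* Beyond the last core the value 0 is a filler that is never evaluated. *)
pose mid nu : 'I_b -> 'M[R]_(r0 nu, r0 nu.+1) :=
  match boolP (nu < n)%N with
  | AltTrue h => cmid (Ordinal h)
  | AltFalse _ => fun=> 0
  end.
have midE (nu : 'I_n) : mid nu = cmid nu.
  case: nu => nu h; rewrite /mid /=; case: {-}_ / boolP => [h'|]; last by rewrite h.
  by rewrite (bool_irrelevance h' h).
have [|F [cF HF]] := @tn_tail_chain n r0 mid last.
  by move=> nu nun; exact: (rpos (Ordinal (nun : (nu < n.+1)%N))).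
exists (r0 0%N), (fun i => \matrix_(k, l) first i l), F,
  (\sum_(nu < n) \sum_i l0_mx (mid nu i) + l0_mx last)%N; split => //.
- exact: (rpos ord0).
- rewrite /tn_l0 /= addnA; under [in leqRHS]eq_bigr do rewrite -midE.
  rewrite leq_add2r leq_add2r [l0_mx first]l0_mxE; apply: leq_sum => i _.
  rewrite l0_mxE big_ord1; apply: leq_sum => l _; by rewrite mxE.
- move=> k0 a; apply: (@ae_tmaps _ b hb n) => j.
  apply: filterS2 (Hf (dcons a j)) (ae01 R) => y /(_ I) + y01.
  rewrite /tensorize tmap_dcons => ->.
  rewrite /tn_eval /= dcons0.
  have := sum_paths mid last (fun k => first a k) j y.
  under [in X in _ = X -> _]eq_bigr do rewrite -HF//.
  move=> E; under [RHS]eq_bigr do rewrite mxE; rewrite -E.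
  apply: eq_bigr => k _; rewrite big_distrr/=; apply: eq_bigr => l _.
  rewrite mulrA; congr (_ * _ * _ * _).
  by apply: eq_bigr => nu _; rewrite midE dconsS.
Qed.

(** Defined by cases so that [rank_cons s r nu.+1] reduces to [r nu] and matrices compose without
    casts. *)
Definition rank_cons (s : nat) (r : nat -> nat) (nu : nat) := if nu is nu'.+1 then r
    nu' else s.

Lemma tn_tail_of_chain n s (F : 'I_s -> R -> R) c : chain n F c ->
  exists (r : nat -> nat) (mid : forall nu, 'I_b -> 'M[R]_(rank_cons s r nu, r nu))
    (last : 'M[R]_(rank_cons s r n, m)),
  [/\ forall nu, (0 < r nu)%N,
      (\sum_(nu < n) \sum_i l0_mx (mid nu i) + l0_mx last <= c)%N
    & forall k (i : {ffun 'I_n -> 'I_b}), \forall y \ae mu,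
        F k (tmap i y) = tn_tail (r := rank_cons s r) mid last k i y].
Proof.
elim: n s F c => [|n IH] s F c.
  move=> [W Wc H]; exists (fun=> 1%N), (fun _ _ => 0), W; split => //.
    by rewrite big_ord0.
  by move=> k i; apply: filterS (H k) => y; rewrite tmap0.
move=> [s' [A [G [c' [s0 Ac HA /IH[r [mid [last [r0 lc HG]]]]]]]]].
exists (rank_cons s' r), (fun nu => match nu as nu return
  'I_b -> 'M[R]_(rank_cons s (rank_cons s' r) nu, rank_cons s' r nu) with
  0 => A | nu'.+1 => mid nu' end), last; split.
- by case.
- by rewrite big_ord_recl/= -addnA (leq_trans _ Ac)// leq_add2l.
- move=> k i; set j := [ffun l : 'I_n => i (lift ord0 l)].
  have HG' := ae_forall (fun l => HG l j).
  apply: filterS2 (ae_tmap hb j (HA k (i ord0))) HG' => y Hy HGy.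
  by rewrite tmapS Hy; apply: eq_bigr => l _; rewrite HGy.
Qed.

Lemma tn_of_chain n f c : chain n.+1 (fun _ : 'I_1 => f) c ->
  exists (r : 'I_n.+1 -> nat) (v : tn_params R b m r),
  [/\ forall nu, (0 < r nu)%N, tn_realizes v phi f & (tn_l0 v <= c)%N].
Proof.
move=> [s [A [G [c' [s0 Ac HA /tn_tail_of_chain[r [mid [last [r0 lc HG]]]]]]]]].
pose r' := rank_cons s r.
pose first : 'M[R]_(b, r' 0%N) := \matrix_(i, l) A i ord0 l.
exists (fun nu : 'I_n.+1 => r' nu).
exists (@TNParams R b n m (fun nu : 'I_n.+1 => r' nu) first (fun nu => mid nu) last);
    split.
- by move=> [[|nu] h]; [exact: s0|exact: r0].
- move=> i; set j := [ffun l : 'I_n => i (lift ord0 l)].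
  have HG' := ae_forall (fun l => HG l j).
  apply: filterS2 (ae_tmap hb j (HA ord0 (i ord0))) HG' => y Hy HGy _.
  rewrite /tensorize tmapS Hy /tn_eval /=.
  have := @sum_paths n r' mid last (fun k => first (i ord0) k) j y.
  under [in X in _ = X -> _]eq_bigr do rewrite -HGy mxE.
  move=> <-; apply: eq_bigr => k _; rewrite big_distrr/=; apply: eq_bigr => l _.
  rewrite mulrA; congr (_ * _ * _ * _).
  by apply: eq_bigr => nu _; rewrite ffunE.
- rewrite /tn_l0 /= -addnA; apply: leq_trans Ac; apply: leq_add => //.
  rewrite l0_mxE; apply: leq_sum => i _.
  rewrite l0_mxE big_ord1; apply: leq_sum => l _; by rewrite mxE.
Qed.

End NetworkChains.

(** * Comparison and quasi-additivity of the three complexities *)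

Section ComplexityBounds.
Context {R : realType} (b : nat) (hb : (0 < b)%N) (p : \bar R).
Local Notation mu := (mu01 R).
Local Notation rk := (rk b).
Variables (S : set (R -> R)) (hS : Lp_subspace p S).
Variables (m : nat) (phi : 'I_m -> R -> R) (hphi : Lp_basis S phi).
Hypothesis hdil : dilation_closed b S.
Local Notation Vd := (Vd b S).
Local Notation Vb := (Vb b S).
Local Notation depth := (depth b S).
Local Notation chain := (@chain R b m phi).
Implicit Types f g : R -> R.

Lemma compl_S_le n f c : chain n.+1 (fun _ : 'I_1 => f) c -> (compl_S b phi f <= c)%N.
Proof.
move=> /(tn_of_chain hb)[r [v [r0 vf vc]]]; apply: leq_trans vc.
by apply: min_nat_le; exists n, r, v.
Qed.

(** Networks for f exist by [chain_rank], or by [chain0] for a null function, so the minimum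
    defining [compl_S] is attained. *)
Lemma compl_S_chain f : Vb f -> exists n, chain n.+1 (fun _ : 'I_1 => f) (compl_S b phi
    f).
Proof.
move=> Vf; have [n [c cf]] : exists n c, chain n.+1 (fun _ : 'I_1 => f) c.
  have [f0|f0] := pselect (\forall x \ae mu, f x = 0).
    by exists 0%N, 0%N; exact: chain0.
  have := chain_rank hb hphi Vf f0; have [] := depthP Vf.
  by case: (depth f) => // n _ _ cf; exists n, (compl_C b S m f).
have [r [v [r0 vf vc]]] := tn_of_chain hb cf.
rewrite /compl_S.
have [n' [r' [v' [r0' vf' ->]]]] := @min_nat_in [set c | exists (n : nat) (r : 'I_n.+1
    -> nat)
  (v : tn_params R b m r), [/\ forall nu, (0 < r nu)%N, tn_realizes v phi f & c = tn_l0
      v]] (tn_l0 v)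
  (ex_intro _ n (ex_intro _ r (ex_intro _ v (And3 r0 vf erefl)))).
by exists n'; exact: chain_of_tn.
Qed.

Lemma compl_S_le_C f : Vb f -> (compl_S b phi f <= compl_C b S m f)%N.
Proof.
move=> Vf; have [f0|f0] := pselect (\forall x \ae mu, f x = 0).
  by rewrite (leq_trans (compl_S_le (chain0 hb phi f0))).
have := chain_rank hb hphi Vf f0; have [] := depthP Vf.
by case: (depth f) => // n _ _; exact: compl_S_le.
Qed.

(** An optimal network puts f in V_(n+1), hence is at least as deep as f; its further levels only
    add terms to the sum of [rho]. *)
Lemma compl_N_le_S f : Vb f -> (compl_N b S f <= compl_S b phi f)%N.
Proof.
move=> Vf; have [n cf] := compl_S_chain Vf.
have mf := Vb_measurable hb hS Vf.
have dn : (depth f <= n.+1)%N by apply: depth_leq => //; exact: (chain_Vd hb hS hphi mf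
    cf).
have [rho [rhoc Hrho]] := chain_rk hb cf.
rewrite (compl_NE hb)//; apply: leq_trans rhoc.
rewrite /rksum [leqRHS](@big_cat_nat _ _ _ (depth f).+1)//=.
apply: leq_trans (leq_addr _ _); rewrite big_nat [leqRHS]big_nat.
apply: leq_sum => nu /andP[nu0 nud]; apply: min_nat_le.
have [|w Hw] := Hrho nu; first by rewrite nu0 (leq_trans _ dn).
by exists w => j; exact: (Hw ord0).
Qed.

(** The properties of a complexity on V_b from which [admissible_quasinormed] deduces that the
    approximation classes are quasi-normed spaces. *)
Definition admissible (compl : (R -> R) -> nat) :=
  [/\ forall f, Vb f -> compl f = 0%N -> \forall x \ae mu, f x = 0,
      compl (cst 0) = 0%N,
      forall c f, c != 0 -> Vb f -> (compl (fun x => c * f x)%R <= compl f)%N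
    & exists K, forall f g, Vb f -> Vb g ->
        (compl (fun x => f x + g x)%R <= K * (compl f + compl g))%N].

Lemma admissible_rksum (h : nat -> nat) : h 0%N = 0%N -> (forall x, (x <= h x)%N) ->
  {homo h : x y / (x <= y)%N} -> (forall x y, (h (x + y) <= 2 * (h x + h y))%N) ->
  admissible (rksum b S h).
Proof.
move=> h0 hge hle hD; split.
- by move=> f; exact: rksum_eq0.
- by apply: rksum0 => //; exact: aeW.
- by move=> c f c0 _; rewrite (rksumZ _ hS).
- by exists (2 + 2 * h m)%N => f g Vf Vg; exact: (rksumD hb hS hphi hdil h0 hge hle hD).
Qed.

Lemma admissible_equiv (compl compl' : (R -> R) -> nat) (K : nat) :
  (forall f, Vb f -> (compl f <= compl' f)%N) ->
  (forall f, Vb f -> (compl' f <= K * compl f)%N) ->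
  (forall c f, c != 0 -> Vb f -> (compl' (fun x => c * f x)%R <= compl' f)%N) ->
  admissible compl -> admissible compl'.
Proof.
move=> le1 le2 leZ [H0 H1 H2 [L H3]]; split => //.
- by move=> f Vf f0; apply: H0 => //; apply/eqP; rewrite -leqn0 -f0 le1.
- apply/eqP; rewrite -leqn0 (leq_trans (le2 _ _)) ?H1 ?muln0//; exact: (Vb0 _ hS).
- exists (K * L)%N => f g Vf Vg.
  apply: leq_trans (le2 _ (VbD hS hdil Vf Vg)) _; rewrite -mulnA leq_mul2l.
  apply/orP; right; apply: leq_trans (H3 _ _ Vf Vg) _.
  by rewrite leq_mul2l leq_add ?orbT// le1.
Qed.

Lemma admissible_N : admissible (compl_N b S).
Proof.
have [] := @admissible_rksum id => //; first by move=> x y; rewrite leq_pmull.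
move=> H0 H1 H2 [K H3]; split.
- by move=> f Vf; rewrite (compl_NE hb)//; exact: H0.
- by rewrite (compl_NE hb)//; exact: (Vb0 _ hS).
- by move=> c f c0 Vf; rewrite !(compl_NE hb)//; [exact: H2|exact: (VbZ hS)].
- exists K => f g Vf Vg; rewrite !(compl_NE hb)//; [exact: H3|exact: (VbD hS hdil)].
Qed.

Lemma admissible_C : admissible (compl_C b S m).
Proof.
apply: (@admissible_equiv (rksum b S (fun x => x ^ 2)%N) _ (3 * b + m)).
- by move=> f Vf; exact: (rksum_sq_le_compl_C hb).
- by move=> f Vf; exact: (compl_C_le_rksum_sq hb).
- move=> c f c0 Vf; rewrite !(compl_CE hb)//; last exact: (VbZ hS).
  rewrite (depthZ _ hS)// !rkZ// leq_add2r leq_add2l leq_mul2l.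
  by apply/orP; right; apply: leq_sum => k _; rewrite !rkZ.
- apply: admissible_rksum => //.
  + by case=> // x; rewrite -mulnn leq_pmulr.
  + by move=> x y xy; rewrite leq_exp2r.
  + by move=> x y; rewrite sqrnD [leqRHS]mul2n -addnn leq_add2l; have [] := nat_Cauchy
      x y.
Qed.

Lemma admissible_S : admissible (compl_S b phi).
Proof.
split.
- move=> f Vf f0; have [H _ _ _] := admissible_N; apply: H => //.
  by apply/eqP; rewrite -leqn0 -f0 compl_N_le_S.
- by apply/eqP; rewrite -leqn0; apply: compl_S_le; apply: chain0 => //; exact: aeW.
- move=> c f _ Vf; have [n cf] := compl_S_chain Vf.
  by apply: compl_S_le; exact: (chainZ (F := fun _ : 'I_1 => f) c cf).
(* The first term is the factor of [chain_extend]; the second multiplies compl_S g, which pays for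
   its own network, for at most b m^2 entries on each new level and for the final identity
   matrix. *)
exists ((b * m).+1 + (b * (m * m) + m).+1)%N => f g.
(* The depths belong to a choice of optimal networks, so the symmetry assumption is that they can be
   chosen with the one of f no deeper than the one of g. *)
wlog: f g / (forall n n', chain n.+1 (fun _ : 'I_1 => f) (compl_S b phi f) ->
    chain n'.+1 (fun _ : 'I_1 => g) (compl_S b phi g) ->
    exists k k', [/\ chain k.+1 (fun _ : 'I_1 => f) (compl_S b phi f),
    chain k'.+1 (fun _ : 'I_1 => g) (compl_S b phi g) & (k <= k')%N]).
  move=> wl Vf Vg; have [n cf] := compl_S_chain Vf; have [n' cg] := compl_S_chain Vg.
  have [nn'|n'n] := leqP n n'.
    by apply: wl => // *; exists n, n'.
  rewrite [X in (_ * X)%N]addnC.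
  have -> : (fun x => f x + g x) = (fun x => g x + f x) by apply/funext => x; rewrite
      addrC.
  by apply: wl => // *; exists n', n; split => //; exact: ltnW.
move=> wl Vf Vg; have [n0 cf] := compl_S_chain Vf; have [n'0 cg] := compl_S_chain Vg.
have [n [n' [{}cf {}cg nn']]] := wl _ _ cf cg.
(* Null summands are removed so that [chain_depth] applies: from f nonzero it yields m > 0, from g
   nonzero the bound of n' by compl_S g. *)
have [f0|f0] := pselect (\forall x \ae mu, f x = 0).
  apply: (@leq_trans (compl_S b phi g)); last by rewrite (leq_trans (leq_addl (compl_S
      b phi f) _))// leq_pmull.
  apply: (@compl_S_le n'); apply: chain_ae cg => // _.
  by apply: filterS f0 => x ->; rewrite add0r.
have [g0|g0] := pselect (\forall x \ae mu, g x = 0).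
  apply: (@leq_trans (compl_S b phi f)).
    apply: (@compl_S_le n); apply: chain_ae cf => // _.
    by apply: filterS g0 => x ->; rewrite addr0.
  by rewrite (leq_trans (leq_addr (compl_S b phi g) _))// leq_pmull.
have [_ m0] := chain_depth hb (k := ord0) cf f0; have [n'c _] := chain_depth hb (k :=
    ord0) cg g0.
move: nn'; rewrite leq_eqVlt => /predU1P[E|nn'].
  rewrite E in cf; apply: leq_trans (compl_S_le (chainD cf cg)) _.
  by rewrite leq_pmull.
have := chain_extend hb hphi hdil (n' - n.+1) m0 cf.
have -> : (n.+1 + (n' - n.+1).+1 = n'.+1)%N by lia.
move=> {}cf; apply: leq_trans (compl_S_le (chainD cf cg)) _.
set K := (b * (m * m))%N.
have h1 : ((n' - n.+1) * K <= compl_S b phi g * K)%N by rewrite leq_mul2r; apply/orP;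
    right; lia.
have h2 : (m <= compl_S b phi g * m)%N by rewrite leq_pmull//; lia.
nia.
Qed.

End ComplexityBounds.

(** * Powers of extended real numbers *)

Section ExtendedPowers.
Context {R : realType}.
Local Open Scope ereal_scope.
Implicit Types (x y : \bar R) (r : R).

Lemma lee_poweR r x y : (0 <= r)%R -> 0 <= x -> x <= y -> x `^ r <= y `^ r.
Proof.
move=> r0 x0 xy; apply: gt0_ler_poweR => //; rewrite in_itv/= ?leey ?andbT//.
exact: le_trans xy.
Qed.

(** From x + y <= 2 max(x, y), which works for exponents below and above 1 alike. *)
Lemma poweRD_le r x y : (0 < r)%R -> 0 <= x -> 0 <= y ->
  (x + y) `^ r <= (2 `^ r)%:E * (x `^ r + y `^ r).
Proof.
move=> r0; wlog xy : x y / x <= y.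
  move=> wl x0 y0; have [xy|yx] := leP x y; first exact: wl.
  by rewrite addeC [X in _ * X]addeC; apply: wl => //; exact: ltW.
move=> x0 y0; apply: (@le_trans _ _ ((2%:E * y) `^ r)).
  apply: lee_poweR; [exact: ltW|exact: adde_ge0|].
  by rewrite (mule_natl y 2) mule2n leeD2r.
rewrite poweRM// poweR_EFin lee_wpmul2l ?lee_fin ?powR_ge0//.
by rewrite leeDr// poweR_ge0.
Qed.

Lemma mul2_powR_ge1 r : (0 < r)%R -> (1 <= 2 * 2 `^ r^-1 :> R)%R.
Proof.
move=> r0; rewrite -[leLHS]mulr1 ler_pM ?ler1n//.
have : (1 `^ r^-1 <= 2 `^ r^-1 :> R)%R.
  by rewrite ge0_ler_powR ?nnegrE ?invr_ge0 ?ltW// ltr1n.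
by rewrite powR1.
Qed.

Lemma poweRVK r x : (0 < r)%R -> 0 <= x -> (x `^ r) `^ r^-1 = x.
Proof. by move=> r0 x0; rewrite -poweRrM mulfV ?gt_eqF// poweRe1. Qed.

End ExtendedPowers.

(** * The quasi-norm of L^p for every p > 0 *)

Section LpQuasiNorm.
Context d (T : measurableType d) (R : realType).
Variable mu : {measure set T -> \bar R}.
Implicit Types (f g : T -> R) (p : \bar R).
Local Open Scope ereal_scope.

Let measurable_abs_poweR f r : measurable_fun setT f ->
  measurable_fun setT (fun x => `|(f x)%:E| `^ r).
Proof.
move=> mf; apply: (@measurableT_comp _ _ _ _ _ _ (fun x : \bar R => x `^ r)).
  exact: measurable_poweR.
by apply: measurableT_comp => //; exact/measurable_EFinP.
Qed.

(** For finite p, [poweRD_le] is used twice: under the integral, giving (2^p)^(1/p) = 2, and on the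
    outer power, giving 2^(1/p). For p infinite it is the Minkowski inequality. *)
Lemma Lnorm_quasi_triangle p : 0 < p -> exists C : R, (1 <= C)%R /\
  forall f g, measurable_fun setT f -> measurable_fun setT g ->
    Lnorm mu p (EFin \o (fun x => f x + g x)%R) <=
    C%:E * (Lnorm mu p (EFin \o f) + Lnorm mu p (EFin \o g)).
Proof.
case: p => [r||//] r0; last first.
  exists 1%R; split => // f g mf mg; rewrite mul1e.
  by apply: (eminkowski mu mf mg); rewrite leey.
rewrite lte_fin in r0.
exists (2 * 2 `^ r^-1)%R; split; first exact: mul2_powR_ge1.
move=> f g mf mg; rewrite unlock /Lnorm.
set If := \int[mu]_x (`|(EFin \o f) x| `^ r).
set Ig := \int[mu]_x (`|(EFin \o g) x| `^ r).
have If0 : 0 <= If by apply: integral_ge0 => x _; exact: poweR_ge0.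
have Ig0 : 0 <= Ig by apply: integral_ge0 => x _; exact: poweR_ge0.
have rV0 : (0 < r^-1)%R by rewrite invr_gt0.
apply: (@le_trans _ _ (((2 `^ r)%:E * (If + Ig)) `^ r^-1)).
  apply: lee_poweR; [exact: ltW| |].
    by apply: integral_ge0 => x _; exact: poweR_ge0.
  rewrite -ge0_integralD//; [|by move=> x _; exact: poweR_ge0|exact: measurable_abs_poweR
    |by move=> x _; exact: poweR_ge0|exact: measurable_abs_poweR].
  rewrite -ge0_integralZl//; [|by apply: emeasurable_funD; exact: measurable_abs_poweR
    |by move=> x _; rewrite adde_ge0// poweR_ge0].
  apply: ge0_le_integral => //.
  - by move=> x _; exact: poweR_ge0.
  - by apply: measurable_abs_poweR; exact: measurable_funD.
  - apply: emeasurable_funM => //; apply: emeasurable_funD; exact: measurable_abs_poweR.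
  - move=> x _; apply: le_trans (poweRD_le r0 (abse_ge0 _) (abse_ge0 _)).
    apply: lee_poweR; [exact: ltW|exact: abse_ge0|].
    by rewrite /= lee_fin ler_normD.
clearbody If Ig; rewrite poweRM ?adde_ge0 ?lee_fin ?powR_ge0//.
rewrite poweR_EFin -powRrM mulfV ?gt_eqF// powRr1//.
rewrite EFinM -muleA lee_wpmul2l ?lee_fin//.
exact: poweRD_le.
Qed.

Lemma eq_Lnorm_ae p f g : 0 < p -> measurable_fun setT f -> measurable_fun setT g ->
  (\forall x \ae mu, f x = g x) ->
  Lnorm mu p (EFin \o f) = Lnorm mu p (EFin \o g).
Proof.
case: p => [r||//] r0 mf mg fg; rewrite unlock /Lnorm.
  congr (_ `^ _); apply: ge0_ae_eq_integral => //.
  - exact: measurable_abs_poweR.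
  - exact: measurable_abs_poweR.
  - by move=> x _; exact: poweR_ge0.
  - by move=> x _; exact: poweR_ge0.
  - by apply: filterS fg => x /= -> _.
case: ifP => // _; apply: eq_ess_sup.
by apply: filterS fg => x /= ->.
Qed.

Lemma Lnorm_scale p f (c : R) : 0 < p -> measurable_fun setT f ->
  Lnorm mu p (EFin \o (fun x => c * f x)%R) = `|c|%:E * Lnorm mu p (EFin \o f).
Proof.
case: p => [r||//] r0 mf; rewrite unlock /Lnorm.
  rewrite lte_fin in r0.
  have -> : \int[mu]_x (`|(EFin \o (fun x => c * f x)%R) x| `^ r) =
            (`|c| `^ r)%:E * \int[mu]_x (`|(EFin \o f) x| `^ r).
    rewrite -ge0_integralZl//; [|exact: measurable_abs_poweR
      |by move=> x _; exact: poweR_ge0].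
    by apply: eq_integral => x _; rewrite /= normrM powRM.
  rewrite poweRM ?lee_fin ?powR_ge0//; last first.
    by apply: integral_ge0 => x _; exact: poweR_ge0.
  by rewrite poweR_EFin -powRrM mulfV ?gt_eqF// powRr1.
case: ifPn => mu0; last by rewrite mule0.
rewrite -ess_supZl//; apply/eq_ess_sup/nearW => t /=.
by rewrite normrM EFinM.
Qed.

End LpQuasiNorm.

(** * Weighted sequence norms and comparison by blocks *)

Section WeightedNorm.
Context {R : realType}.
Implicit Types (alpha : R) (q : \bar R) (E : nat -> \bar R).
Local Open Scope ereal_scope.

Definition wterm alpha E n := (n.+1%:R `^ alpha)%:E * E n.

(** [approx_norm] as a function of the sequence of best errors alone, so that classes are compared
    through sequences. *)
Definition wnorm alpha q E : \bar R :=
  match q with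
  | q'%:E => (\sum_(0 <= n <oo) (wterm alpha E n) `^ q' * (n.+1%:R^-1)%:E) `^ q'^-1
  | +oo => ereal_sup (range (wterm alpha E))
  | -oo => 0
  end.

Lemma wterm_ge0 alpha E n : (forall n, 0 <= E n) -> 0 <= wterm alpha E n.
Proof. by move=> E0; rewrite mule_ge0// lee_fin powR_ge0. Qed.

Let wsum_ge0 alpha E (q : R) n : 0 <= (wterm alpha E n) `^ q * (n.+1%:R^-1)%:E.
Proof. by rewrite mule_ge0 ?poweR_ge0// lee_fin invr_ge0. Qed.

Let series_ge0 alpha E (q : R) : 0 <= \sum_(0 <= n <oo) (wterm alpha E n) `^ q *
    (n.+1%:R^-1)%:E.
Proof. by apply: nneseries_ge0 => n _ _; exact: wsum_ge0. Qed.

Lemma wnorm_ge0 alpha q E : (forall n, 0 <= E n) -> 0 <= wnorm alpha q E.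
Proof.
move=> E0; case: q => [q'||//]; first exact: poweR_ge0.
by apply: le_trans (wterm_ge0 alpha 0 E0) _; apply: ereal_sup_ubound; exists 0%N.
Qed.

Lemma le_partial_series (u : nat -> \bar R) n : (forall n, 0 <= u n) ->
  \sum_(0 <= k < n) u k <= \sum_(0 <= k <oo) u k.
Proof. by move=> u0; exact: nneseries_lim_ge. Qed.

Lemma series_le (u : nat -> \bar R) x : (forall n, 0 <= u n) ->
  (forall n, \sum_(0 <= k < n) u k <= x) -> \sum_(0 <= k <oo) u k <= x.
Proof.
move=> u0 H; apply: lime_le; first exact: is_cvg_nneseries.
exact: nearW.
Qed.

(** The first term has weight 1. For best errors it is the L^p norm, and this bound makes the
    quasi-norm definite. *)
Lemma wnorm_ge_first alpha q E : 0 < q -> (forall n, 0 <= E n) -> E 0%N <= wnorm alpha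
    q E.
Proof.
move=> q0 E0; have t0 : wterm alpha E 0 = E 0%N by rewrite /wterm powR1 mul1e.
case: q q0 => [q'||//] q0.
  rewrite lte_fin in q0.
  rewrite -[leLHS](poweRVK q0 (E0 0%N)); apply: lee_poweR.
  - by rewrite invr_ge0 ltW.
  - exact: poweR_ge0.
  apply: le_trans (@le_partial_series _ 1 (wsum_ge0 alpha E q')).
  by rewrite big_nat1 t0 invr1 mule1.
by rewrite -t0; apply: ereal_sup_ubound; exists 0%N.
Qed.

Lemma wnormZ alpha q E (c : R) : 0 < q -> (0 <= c)%R -> (forall n, 0 <= E n) ->
  wnorm alpha q (fun n => c%:E * E n) = c%:E * wnorm alpha q E.
Proof.
move=> q0 c0 E0.
have tE n : wterm alpha (fun n => c%:E * E n) n = c%:E * wterm alpha E n.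
  by rewrite /wterm muleCA.
case: q q0 => [q'||//] q0.
  rewrite lte_fin in q0; rewrite /wnorm.
  under eq_eseriesr => n _.
    rewrite tE poweRM ?lee_fin ?wterm_ge0// -muleA poweR_EFin.
    over.
  rewrite nneseriesZl; last by move=> n _; exact: wsum_ge0.
  rewrite poweRM ?lee_fin ?powR_ge0 ?series_ge0//.
  by rewrite poweR_EFin -powRrM mulfV ?gt_eqF// powRr1.
(* For c = 0 both sides vanish even if the norm of E is infinite, but dividing by c is
   impossible. *)
rewrite /wnorm; have [->|cn0] := eqVneq c 0%R.
  rewrite mul0e; apply/eqP; rewrite eq_le; apply/andP; split.
    by apply: ge_ereal_sup => _ [n _ <-]; rewrite /wterm mul0e mule0.
  apply: (@le_trans _ _ (wterm alpha (fun n => 0%:E * E n) 0)).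
    by rewrite /wterm mul0e mule0.
  by apply: ereal_sup_ubound; exists 0%N.
have cp : (0 < c)%R by rewrite lt_neqAle eq_sym cn0.
apply/eqP; rewrite eq_le; apply/andP; split.
  apply: ge_ereal_sup => _ [n _ <-]; rewrite tE lee_wpmul2l ?lee_fin//.
  by apply: ereal_sup_ubound; exists n.
rewrite muleC -lee_pdivlMr//; apply: ge_ereal_sup => _ [n _ <-].
rewrite lee_pdivlMr// muleC -tE.
by apply: ereal_sup_ubound; exists n.
Qed.

Lemma wnormD_le alpha q : 0 < q -> exists C : R, (1 <= C)%R /\
  forall E E', (forall n, 0 <= E n) -> (forall n, 0 <= E' n) ->
    wnorm alpha q (fun n => E n + E' n) <= C%:E * (wnorm alpha q E + wnorm alpha q E').
Proof.
have tE E E' n : (forall n, 0 <= E n) -> (forall n, 0 <= E' n) ->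
    wterm alpha (fun n => E n + E' n) n = wterm alpha E n + wterm alpha E' n.
  by move=> E0 E0'; rewrite /wterm ge0_muleDr.
case: q => [q||//] q0; last first.
  exists 1%R; split => // E E' E0 E0'; rewrite mul1e.
  apply: ge_ereal_sup => _ [n _ <-]; rewrite tE//.
  by apply: leeD; apply: ereal_sup_ubound; exists n.
rewrite lte_fin in q0; have qV0 : (0 < q^-1)%R by rewrite invr_gt0.
exists (2 * 2 `^ q^-1)%R; split; first exact: mul2_powR_ge1.
move=> E E' E0 E0'; rewrite /wnorm.
set s := \sum_(0 <= n <oo) (wterm alpha E n) `^ q * _.
set s' := \sum_(0 <= n <oo) (wterm alpha E' n) `^ q * _.
apply: (@le_trans _ _ (((2 `^ q)%:E * (s + s')) `^ q^-1)).
  apply: lee_poweR; [exact: ltW|exact: series_ge0|].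
  rewrite -nneseriesD; [|by move=> n _ _; exact: wsum_ge0..].
  rewrite -nneseriesZl; last by move=> n _; rewrite adde_ge0.
  apply: lee_nneseries => [n _ _|n _]; first exact: wsum_ge0.
  rewrite -ge0_muleDl ?poweR_ge0// muleA lee_wpmul2r ?lee_fin ?invr_ge0//.
  by rewrite tE//; apply: poweRD_le => //; exact: wterm_ge0.
rewrite poweRM ?adde_ge0 ?lee_fin ?powR_ge0 ?series_ge0//.
rewrite poweR_EFin -powRrM mulfV ?gt_eqF// powRr1//.
rewrite EFinM -muleA lee_wpmul2l ?lee_fin//.
by apply: poweRD_le => //; exact: series_ge0.
Qed.

(* The indices in [B k, B k.+1[ contribute to the norm of E' a bounded multiple
   of what k contributes to the norm of E. *)
Lemma wnorm_blocks (B : nat -> nat) (K s C2 : nat) alpha q : (0 < q) -> (0 < alpha)%R ->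
  (0 < s)%N -> B 0%N = 0%N -> (forall k, (B k < B k.+1)%N) ->
  (forall k, (B k.+1 <= K * k.+1 ^ s)%N) ->
  (forall k, (k.+1 * (B k.+1 - B k) <= C2 * (B k).+1)%N) ->
  exists C : R, (0 <= C)%R /\ forall E E', (forall n, 0 <= E n) -> (forall n, 0 <= E'
      n) ->
    (forall k n, (B k <= n < B k.+1)%N -> E' n <= E k) ->
    wnorm (alpha / s%:R) q E' <= C%:E * wnorm alpha q E.
Proof.
move=> q0 a0 s0 B0 Blt BK BC2.
(* From n + 1 <= K (k + 1)^s, the power alpha / s gives (n + 1)^(alpha / s) <= C1 (k + 1)^alpha. *)
pose C1 : R := (K%:R `^ (alpha / s%:R))%R.
have C10 : (0 <= C1)%R by exact: powR_ge0.
have w k n : (B k <= n < B k.+1)%N ->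
    (n.+1%:R `^ (alpha / s%:R) <= C1 * k.+1%:R `^ alpha)%R.
  move=> /andP[_ nB]; have nK : (n.+1 <= K * k.+1 ^ s)%N by exact: leq_trans (BK k).
  apply: (@le_trans _ _ ((K * k.+1 ^ s)%:R `^ (alpha / s%:R))%R).
    rewrite ge0_ler_powR ?nnegrE ?ler0n ?ler_nat//.
    by rewrite divr_ge0 ?ler0n// ltW.
  rewrite natrM powRM ?ler0n// ler_wpM2l// natrX -powR_mulrn ?ler0n//.
  by rewrite -powRrM mulrCA mulfV ?mulr1// pnatr_eq0 -lt0n.
have term_le E E' k n : (forall n, 0 <= E n) -> (forall n, 0 <= E' n) ->
    (forall k n, (B k <= n < B k.+1)%N -> E' n <= E k) ->
    (B k <= n < B k.+1)%N ->
    wterm (alpha / s%:R) E' n <= C1%:E * wterm alpha E k.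
  move=> E0 E0' EE kn; rewrite /wterm muleA -EFinM lee_pmul//.
  - by rewrite lee_fin w.
  - exact: EE.
have block n : exists k, (B k <= n < B k.+1)%N.
  elim: n => [|n [k /andP[kn nk]]]; first by exists 0%N; have := Blt 0%N; rewrite B0.
  move: nk; rewrite leq_eqVlt => /predU1P[E|nk]; last first.
    by exists k; rewrite nk (leq_trans kn).
  by exists k.+1; rewrite E leqnn Blt.
case: q q0 => [q||//] q0; last first.
  exists C1; split => // E E' E0 E0' EE.
  apply: ge_ereal_sup => _ [n _ <-]; have [k kn] := block n.
  apply: le_trans (term_le _ _ _ _ E0 E0' EE kn) _.
  rewrite lee_wpmul2l ?lee_fin//.
  by apply: ereal_sup_ubound; exists k.
rewrite lte_fin in q0; have qV0 : (0 < q^-1)%R by rewrite invr_gt0.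
exists (C1 * C2%:R `^ q^-1)%R; split; first by rewrite mulr_ge0 ?powR_ge0.
move=> E E' E0 E0' EE; rewrite /wnorm.
set v := fun k => (wterm alpha E k) `^ q * (k.+1%:R^-1)%:E.
set u := fun n => (wterm (alpha / s%:R) E' n) `^ q * (n.+1%:R^-1)%:E.
have v0 k : 0 <= v k by exact: wsum_ge0.
have u0 n : 0 <= u n by exact: wsum_ge0.
(* The weights give C1^q. Block k has at most C2 (B k + 1) / (k + 1) terms, each with a factor at
   most 1 / (B k + 1), which leaves C2 / (k + 1). *)
pose C := (C1 `^ q * C2%:R)%R.
have C0 : (0 <= C)%R by rewrite mulr_ge0 ?powR_ge0.
have uv k : \sum_(B k <= n < B k.+1) u n <= C%:E * v k.
  apply: (@le_trans _ _ (\sum_(B k <= n < B k.+1)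
      ((C1 `^ q)%:E * (wterm alpha E k) `^ q) * ((B k).+1%:R^-1)%:E)).
    rewrite big_nat [leRHS]big_nat; apply: lee_sum => n kn.
    apply: lee_pmul; [exact: poweR_ge0|by rewrite lee_fin invr_ge0| |].
      rewrite -poweR_EFin -poweRM ?lee_fin ?wterm_ge0//.
      apply: lee_poweR; [exact: ltW|exact: wterm_ge0|exact: term_le].
    by case/andP: kn => kn _; rewrite lee_fin lef_pV2 ?posrE ?ltr0n// ler_nat ltnS.
  rewrite -ge0_sume_distrr; last by move=> n _; rewrite lee_fin invr_ge0.
  rewrite sumEFin /v /C EFinM -!muleA lee_wpmul2l ?lee_fin ?powR_ge0//.
  rewrite muleCA lee_wpmul2l ?poweR_ge0// -EFinM lee_fin.
  rewrite sumr_const_nat -[leLHS]mulr_natl ler_pdivrMr ?ltr0n//.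
  rewrite mulrAC ler_pdivlMr ?ltr0n// -!natrM ler_nat.
  by rewrite mulnC.
have UV M : \sum_(0 <= n < B M) u n <= C%:E * \sum_(0 <= k < M) v k.
  elim: M => [|M IH]; first by rewrite B0 !big_geq// mule0.
  rewrite (@big_cat_nat _ _ _ (B M))//=; last exact: ltnW.
  rewrite big_nat_recr//= ge0_muleDr ?sume_ge0//.
  exact: leeD.
have MB M : (M <= B M)%N.
  by elim: M => // M IH; exact: leq_ltn_trans IH (Blt M).
apply: (@le_trans _ _ ((C%:E * \sum_(0 <= k <oo) v k) `^ q^-1)).
  apply: lee_poweR; [exact: ltW|exact: series_ge0|].
  apply: series_le => // N; apply: (@le_trans _ _ (\sum_(0 <= n < B N) u n)).
    rewrite [leRHS](@big_cat_nat _ _ _ N)//= leeDl// sume_ge0//.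
  apply: le_trans (UV N) _; rewrite lee_wpmul2l ?lee_fin//.
  exact: le_partial_series.
rewrite poweRM ?lee_fin ?series_ge0// poweR_EFin.
by rewrite /C powRM ?powR_ge0// -powRrM mulfV ?gt_eqF// powRr1.
Qed.

End WeightedNorm.

Lemma Lfun_iff (R : realType) (p : \bar R) (f : R -> R) :
  (f \in Lfun (mu01 R) p) <->
  (measurable_fun setT f /\ (Lnorm (mu01 R) p (EFin \o f) < +oo)%E).
Proof.
rewrite /Lfun inE; split=> [/andP[]|[mf nf]]; first by rewrite !inE.
by apply/andP; split; rewrite inE.
Qed.

(** * Best approximation errors and approximation classes *)

Section BestError.
Context {R : realType} (p : \bar R) (hp : (0 < p)%E).
Local Notation mu := (mu01 R).
Local Notation norm f := (Lnorm mu p (EFin \o f)).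
Local Open Scope ereal_scope.
Implicit Types f g : R -> R.

Lemma best_error_ge0 (Phi : nat -> set (R -> R)) n f : 0 <= best_error p Phi n f.
Proof. by apply: le_ereal_inf_tmp => _ [g _ <-]; exact: Lnorm_ge0. Qed.

Lemma best_error_le_sub (Phi Phi' : nat -> set (R -> R)) n n' f :
  Phi n `<=` Phi' n' -> best_error p Phi' n' f <= best_error p Phi n f.
Proof.
move=> sub; apply: le_ereal_inf_tmp => _ [g Pg <-].
by apply: ereal_inf_lbound; exists g => //; exact: sub.
Qed.

Section Family.
Variable Phi : nat -> set (R -> R).
Hypothesis mPhi : forall n f, Phi n f -> measurable_fun setT f.
Hypothesis Phi_mono : forall n n', (n <= n')%N -> Phi n `<=` Phi n'.
Hypothesis Phi0 : Phi 0%N (cst 0%R).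
Hypothesis Phi0_ae : forall f, Phi 0%N f -> \forall x \ae mu, f x = 0%R.
Hypothesis PhiZ : forall n (c : R) f, c != 0%R -> Phi n f -> Phi n (fun x => c * f x)%R.
Variable K : nat.
Hypothesis K0 : (0 < K)%N.
Hypothesis PhiD : forall n f g, Phi n f -> Phi n g -> Phi (K * n)%N (fun x => f x + g
    x)%R.

Local Notation E := (best_error p Phi).

Let msub f g : measurable_fun setT f -> measurable_fun setT g ->
  measurable_fun setT (fun x => f x - g x)%R.
Proof. by move=> mf mg; exact: measurable_funB. Qed.

Lemma best_error_ae n f g : measurable_fun setT f -> measurable_fun setT g ->
  (\forall x \ae mu, f x = g x) -> E n f = E n g.
Proof.
move=> mf mg fg; congr ereal_inf; apply: eq_imagel => h Ph.
have mh := mPhi Ph.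
apply: eq_Lnorm_ae => //; [exact: msub|exact: msub|].
by apply: filterS fg => x ->.
Qed.

Lemma best_error0 f : measurable_fun setT f -> E 0%N f = norm f.
Proof.
move=> mf; apply/eqP; rewrite eq_le; apply/andP; split.
  apply: ereal_inf_lbound; exists (cst 0%R) => //.
  by apply: eq_Lnorm => x /=; rewrite subr0.
apply: le_ereal_inf_tmp => _ [g Pg <-].
rewrite (@eq_Lnorm_ae _ _ _ mu p f (fun x => f x - g x)%R)//.
  by apply: msub => //; exact: mPhi Pg.
by apply: filterS (Phi0_ae Pg) => x ->; rewrite subr0.
Qed.

Lemma best_error_le_norm n f : E n f <= norm f.
Proof.
apply: ereal_inf_lbound; exists (cst 0%R); first exact: (@Phi_mono 0 n).
by apply: eq_Lnorm => x /=; rewrite subr0.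
Qed.

Lemma best_errorZ_le n c f : measurable_fun setT f -> c != 0%R ->
  E n (fun x => c * f x)%R <= `|c|%:E * E n f.
Proof.
move=> mf c0; rewrite muleC -lee_pdivrMr ?normr_gt0//.
apply: le_ereal_inf_tmp => _ [g Pg <-]; have mg := mPhi Pg.
rewrite lee_pdivrMr ?normr_gt0// muleC -Lnorm_scale//; last exact: msub.
apply: ereal_inf_lbound; exists (fun x => c * g x)%R; first exact: PhiZ.
by apply: eq_Lnorm => x /=; rewrite mulrBr.
Qed.

Lemma best_errorZ n c f : measurable_fun setT f ->
  E n (fun x => c * f x)%R = `|c|%:E * E n f.
Proof.
move=> mf; have [->|c0] := eqVneq c 0%R.
  rewrite normr0 mul0e; apply/eqP; rewrite eq_le best_error_ge0 andbT.
  apply: le_trans (best_error_le_norm _ _) _.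
  by rewrite Lnorm_scale// normr0 mul0e.
apply/eqP; rewrite eq_le best_errorZ_le//= muleC -lee_pdivlMr ?normr_gt0//.
have mcf : measurable_fun setT (fun x => c * f x)%R by exact: measurable_funM.
have := @best_errorZ_le n (c^-1)%R _ mcf; rewrite invr_eq0 => /(_ c0).
by under eq_fun do rewrite mulKf//; rewrite normfV muleC.
Qed.

Lemma best_errorD (C : R) : (1 <= C)%R ->
  (forall f g, measurable_fun setT f -> measurable_fun setT g ->
    norm (fun x => f x + g x)%R <= C%:E * (norm f + norm g)) ->
  forall n f g, measurable_fun setT f -> measurable_fun setT g ->
    E (K * n)%N (fun x => f x + g x)%R <= C%:E * (E n f + E n g).
Proof.
move=> C1 tri n f g mf mg; have C0 : (0 < C)%R by exact: lt_le_trans C1.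
have [fy|fy] := eqVneq (E n f) +oo.
  by rewrite fy addye ?gt0_muley ?leey ?lte_fin// -ltNye (lt_le_trans _ (best_error_ge0
      _ _ _)).
have [gy|gy] := eqVneq (E n g) +oo.
  by rewrite gy addey ?gt0_muley ?leey ?lte_fin// -ltNye (lt_le_trans _ (best_error_ge0
      _ _ _)).
have ff : E n f \is a fin_num by rewrite ge0_fin_numE ?best_error_ge0// ltey.
have gf : E n g \is a fin_num by rewrite ge0_fin_numE ?best_error_ge0// ltey.
(* Two near-minimizers, each with excess e', and the constant C of the triangle inequality give 2 C
   e' = e. *)
apply/lee_addgt0Pr => e e0; pose e' := (e / (2 * C))%R.
have e'0 : (0 < e')%R by rewrite divr_gt0// mulr_gt0.
have [_ [u Pu <-] Hu] := lb_ereal_inf_adherent e'0 ff.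
have [_ [v Pv <-] Hv] := lb_ereal_inf_adherent e'0 gf.
have mu' := mPhi Pu; have mv := mPhi Pv.
apply: (@le_trans _ _ (norm ((fun x => f x + g x) \- (fun x => u x + v x))%R)).
  by apply: ereal_inf_lbound; exists (fun x => u x + v x)%R => //; exact: PhiD.
have -> : ((fun x => f x + g x) \- (fun x => u x + v x))%R =
    (fun x => (f x - u x) + (g x - v x))%R.
  by apply/funext => x /=; ring.
apply: le_trans (tri _ _ (msub mf mu') (msub mg mv)) _.
apply: (@le_trans _ _ (C%:E * ((E n f + e'%:E) + (E n g + e'%:E)))).
  by rewrite lee_wpmul2l ?lee_fin ?(ltW C0)//; apply: leeD; exact: ltW.
rewrite -(fineK ff) -(fineK gf) -!EFinD -!EFinM lee_fin le_eqVlt /e'.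
by apply/orP; left; apply/eqP; field; rewrite gt_eqF.
Qed.

Variables (alpha : R) (halpha : (0 < alpha)%R) (q : \bar R) (hq : 0 < q).

Local Notation A := (approx_class p Phi alpha q).
Local Notation N := (approx_norm p Phi alpha q).

Lemma approx_normE (Phi' : nat -> set (R -> R)) a f :
  approx_norm p Phi' a q f = wnorm a q (fun n => best_error p Phi' n f).
Proof. by []. Qed.

Lemma approx_normZ c f : measurable_fun setT f ->
  N (fun x => c * f x)%R = `|c|%:E * N f.
Proof.
move=> mf; rewrite !approx_normE -wnormZ//; last by move=> n; exact: best_error_ge0.
by congr (wnorm _ _ _); apply/funext => n; exact: best_errorZ.
Qed.

(** For K k <= n < K (k + 1), the error of f + g at n is at most C (E_k f + E_k g). With B k = K k
    and s = 1, [wnorm_blocks] keeps the exponent alpha. *)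
Lemma approx_normD : exists C : R, (1 <= C)%R /\
  forall f g, measurable_fun setT f -> measurable_fun setT g ->
    N (fun x => f x + g x)%R <= C%:E * (N f + N g).
Proof.
have [C [C1 tri]] := Lnorm_quasi_triangle mu hp.
have [C' [C1' HC']] := wnormD_le alpha hq.
have := @wnorm_blocks R (fun k => K * k)%N K 1 K alpha q hq halpha.
case=> //; [by rewrite muln0|by move=> k; rewrite ltn_mul2l K0 ltnSn| |].
  by move=> k; rewrite -mulnBr subSnn muln1; nia.
move=> C2 [C20 HC2].
(* The block constant is only known to be nonnegative, whereas a constant at least 1 is required. *)
exists (Num.max 1 (C2 * (C * C')))%R; split; first by rewrite le_max lexx.
move=> f g mf mg; rewrite !approx_normE.
have C0 : (0 <= C)%R by exact: le_trans C1.
have E0 h n : 0 <= E n h by exact: best_error_ge0.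
apply: (@le_trans _ _ ((C2 * (C * C'))%:E *
   (wnorm alpha q (E^~ f) + wnorm alpha q (E^~ g)))); last first.
  rewrite lee_wpmul2r ?adde_ge0 ?wnorm_ge0// lee_fin.
  by rewrite le_max lexx orbT.
have := HC2 (fun n => C%:E * (E n f + E n g)) (fun n => E n (fun x => f x + g x)%R).
rewrite divr1 => /(_ _ _ _)/le_trans; apply.
- by move=> n; rewrite mule_ge0 ?adde_ge0.
- by [].
- move=> k n /andP[kn _]; apply: le_trans (best_errorD C1 tri _ mf mg).
  by apply: best_error_le_sub; exact: Phi_mono.
rewrite wnormZ//; last by move=> n; rewrite adde_ge0.
rewrite !EFinM -!muleA lee_wpmul2l ?lee_fin// lee_wpmul2l ?lee_fin//.
exact: HC'.
Qed.

(** Definiteness comes from E_0: Phi_0 consists of null functions, so E_0 f is the L^p norm of f,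
    and N f dominates it. *)
Lemma approx_class_quasinormed : quasinormed_space p A N.
Proof.
have AL f : A f -> measurable_fun setT f /\ norm f < +oo by move=> [/Lfun_iff].
have N0 f : 0 <= N f.
  by rewrite approx_normE; apply: wnorm_ge0 => n; exact: best_error_ge0.
have Nle f : measurable_fun setT f -> norm f <= N f.
  move=> mf; rewrite approx_normE -best_error0//.
  by apply: (@wnorm_ge_first _ alpha q (E^~ f)) => // n; exact: best_error_ge0.
have Nae f g : measurable_fun setT f -> measurable_fun setT g ->
    (\forall x \ae mu, f x = g x) -> N f = N g.
  move=> mf mg fg; rewrite !approx_normE; congr (wnorm _ _ _).
  by apply/funext => n; exact: best_error_ae.
have [C [C1 NC]] := approx_normD.
have [D [D1 tri]] := Lnorm_quasi_triangle mu hp.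
have m0 : measurable_fun setT (cst 0%R : R -> R) by exact: measurable_cst.
have Ncst0 : N (cst 0%R) = 0.
  have := approx_normZ 0 m0; rewrite normr0 mul0e => <-.
  by congr N; apply/funext => x; rewrite /= mul0r.
split.
- split.
  + by move=> f [].
  + split; last by rewrite Ncst0.
    apply/Lfun_iff; split => //.
    by rewrite (_ : EFin \o _ = cst 0)// Lnorm0// gt_eqF.
  + move=> c f g Af Ag; have [mf nf] := AL _ Af; have [mg ng] := AL _ Ag.
    have mcf : measurable_fun setT (fun x => c * f x)%R by exact: measurable_funM.
    split.
      apply/Lfun_iff; split; first exact: measurable_funD.
      apply: le_lt_trans (tri _ _ mcf mg) _.
      rewrite lte_mul_pinfty ?lee_fin ?(le_trans _ D1)// lte_add_pinfty//.
      by rewrite Lnorm_scale// lte_mul_pinfty.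
    apply: le_lt_trans (NC _ _ mcf mg) _.
    rewrite lte_mul_pinfty ?lee_fin ?(le_trans _ C1)// lte_add_pinfty//.
      by rewrite approx_normZ// lte_mul_pinfty//; case: Af.
    by case: Ag.
  + move=> f g Af mg fg; have [mf nf] := AL _ Af.
    have fg' : \forall x \ae mu, f x = g x by apply: filterS fg => x /(_ I).
    split.
      by apply/Lfun_iff; split => //; rewrite -(@eq_Lnorm_ae _ _ _ mu p f g).
    by rewrite -(Nae f g)//; case: Af.
- move=> f g /AL[mf _] /AL[mg _] fg; apply: Nae => //.
  by apply: filterS fg => x /(_ I).
- move=> f Af; have [mf nf] := AL _ Af; split; first by rewrite N0; case: Af.
  split=> [Nf0|f0]; last first.
    by rewrite (Nae f (cst 0%R))//; apply: filterS f0 => x /(_ I).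
  have nf0 : norm f = 0 by apply/eqP; rewrite eq_le Lnorm_ge0 -Nf0 Nle.
  have mEf : measurable_fun setT (EFin \o f) by exact/measurable_EFinP.
  have := @Lnorm_eq0_eq0 _ _ R mu (EFin \o f) p mEf hp nf0; apply: filterS => x /= + _
      => /(_ I).
  by move=> [].
- by move=> c f /AL[mf _]; exact: approx_normZ.
- by exists C; split => // f g /AL[mf _] /AL[mg _]; exact: NC.
Qed.

End Family.

Lemma approx_class_embedding (Phi Phi' : nat -> set (R -> R)) (alpha : R) (q : \bar R)
    (B : nat -> nat) (K s C2 : nat) :
  0 < q -> (0 < alpha)%R -> (forall n n', (n <= n')%N -> Phi' n `<=` Phi' n') ->
  (forall k, Phi k `<=` Phi' (B k)) ->
  (0 < s)%N -> B 0%N = 0%N -> (forall k, (B k < B k.+1)%N) ->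
  (forall k, (B k.+1 <= K * k.+1 ^ s)%N) ->
  (forall k, (k.+1 * (B k.+1 - B k) <= C2 * (B k).+1)%N) ->
  continuous_embedding (approx_class p Phi alpha q) (approx_norm p Phi alpha q)
    (approx_class p Phi' (alpha / s%:R)%R q) (approx_norm p Phi' (alpha / s%:R)%R q).
Proof.
move=> q0 a0 mono sub s0 B0 Blt BK BC.
have [C [C0 HC]] := wnorm_blocks q0 a0 s0 B0 Blt BK BC.
have H f : approx_norm p Phi' (alpha / s%:R)%R q f <= C%:E * approx_norm p Phi alpha q f.
  apply: HC => [n|n|k n /andP[kn _]]; [exact: best_error_ge0|exact: best_error_ge0|].
  by apply: best_error_le_sub; apply: subset_trans (mono _ _ kn).
split; last by exists C => f _; exact: H.
move=> f [Lf Nf]; split => //; apply: le_lt_trans (H f) _.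
by rewrite lte_mul_pinfty ?lee_fin.
Qed.

End BestError.

(** * Approximation classes of the complexities and the embeddings *)

Section AdmissibleComplexities.
Context {R : realType} (b : nat) (hb : (0 < b)%N) (p : \bar R) (hp : (0 < p)%E).
Variables (S : set (R -> R)) (hS : Lp_subspace p S) (hdil : dilation_closed b S).

Lemma Phi_mono (compl : (R -> R) -> nat) n n' :
  (n <= n')%N -> Phi b S compl n `<=` Phi b S compl n'.
Proof. by move=> nn' f [Vf fn]; split => //; exact: leq_trans nn'. Qed.

Lemma admissible_quasinormed (compl : (R -> R) -> nat) alpha q :
  admissible b S compl -> 0 < alpha -> (0 < q)%E ->
  quasinormed_space p (approx_class p (Phi b S compl) alpha q)
    (approx_norm p (Phi b S compl) alpha q).
Proof.
move=> [H0 H1 H2 [K H3]] a0 q0.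
(* Two functions of complexity at most n have a sum of complexity at most 2 K n; the successor makes
   the factor positive. *)
apply: (@approx_class_quasinormed R p hp (Phi b S compl) _ _ _ _ _ (2 * K).+1) => //.
- by move=> n f [Vf _]; exact: (Vb_measurable hb hS Vf).
- by move=> n n'; exact: Phi_mono.
- by split; [exact: (Vb0 _ hS)|rewrite H1].
- by move=> f [Vf]; rewrite leqn0 => /eqP; exact: H0.
- move=> n c f c0 [Vf fn]; split; first exact: (VbZ hS).
  exact: leq_trans (H2 _ _ c0 Vf) fn.
- move=> n f g [Vf fn] [Vg gn]; split; first exact: (VbD hS).
  apply: leq_trans (H3 _ _ Vf Vg) _.
  apply: (@leq_trans (K * (n + n))%N); first by rewrite leq_mul2l leq_add ?orbT.
  nia.
Qed.

End AdmissibleComplexities.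

Theorem mainTheorem3 (R : realType) (b : nat) (hb : (2 <= b)%N)
    (p : \bar R) (hp : (0 < p)%E)
    (S : set (R -> R)) (hS : Lp_subspace p S)
    (m : nat) (phi : 'I_m -> R -> R) (hphi : Lp_basis S phi)
    (hdil : dilation_closed b S)
    (alpha : R) (halpha : 0 < alpha) (q : \bar R) (hq : (0 < q)%E) :
  let PhiN := Phi b S (compl_N b S) in
  let PhiC := Phi b S (compl_C b S m) in
  let PhiS := Phi b S (compl_S b phi) in
  [/\ quasinormed_space p (approx_class p PhiN alpha q)
        (approx_norm p PhiN alpha q),
      quasinormed_space p (approx_class p PhiC alpha q)
        (approx_norm p PhiC alpha q)
    & quasinormed_space p (approx_class p PhiS alpha q)
        (approx_norm p PhiS alpha q)] /\
  [/\ continuous_embedding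
        (approx_class p PhiC alpha q) (approx_norm p PhiC alpha q)
        (approx_class p PhiS alpha q) (approx_norm p PhiS alpha q),
      continuous_embedding
        (approx_class p PhiS alpha q) (approx_norm p PhiS alpha q)
        (approx_class p PhiN alpha q) (approx_norm p PhiN alpha q)
    & continuous_embedding
        (approx_class p PhiN alpha q) (approx_norm p PhiN alpha q)
        (approx_class p PhiC (alpha / 2) q) (approx_norm p PhiC (alpha / 2) q)].
Proof.
move=> PhiN PhiC PhiS; have b0 : (0 < b)%N by exact: ltnW.
(* Inclusions at equal index are the case B = id, s = 1, with blocks of one element. *)
have embed1 Phi' Phi'' : (forall n n', (n <= n')%N -> Phi'' n `<=` Phi'' n') ->
    (forall n, Phi' n `<=` Phi'' n) ->
    continuous_embedding
      (approx_class p Phi' alpha q) (approx_norm p Phi' alpha q)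
      (approx_class p Phi'' alpha q) (approx_norm p Phi'' alpha q).
  move=> mono sub.
  have := @approx_class_embedding R p Phi' Phi'' alpha q id 1 1 1 hq halpha mono sub.
  rewrite divr1; apply => // k; first by rewrite mul1n.
  by rewrite subSnn muln1 mul1n.
split; split.
- apply: admissible_quasinormed => //; exact: (admissible_N b0 hS hphi hdil).
- apply: admissible_quasinormed => //; exact: (admissible_C b0 hS hphi hdil).
- apply: admissible_quasinormed => //; exact: (admissible_S b0 hS hphi hdil).
- apply: embed1; first by move=> n n'; exact: Phi_mono.
  move=> n f [Vf fn]; split => //; apply: leq_trans fn.
  exact: (compl_S_le_C b0 hphi Vf).
- apply: embed1; first by move=> n n'; exact: Phi_mono.
  move=> n f [Vf fn]; split => //; apply: leq_trans fn.
  exact: (compl_N_le_S b0 hS hphi Vf).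
(* Here compl_C <= K compl_N^2, so B k = K k^2 and s = 2 halves alpha. Block k has K (2 k + 1)
   indices, and 6 K suffices since (k + 1) (2 k + 1) <= 6 (k^2 + 1). *)
- set K := (3 * b + m)%N; have K0 : (0 < K)%N by rewrite /K; lia.
  apply: (@approx_class_embedding R p PhiN PhiC alpha q (fun k => K * k ^ 2)%N K 2 (6 *
      K)) => //.
  + by move=> n n'; exact: Phi_mono.
  + move=> n f [Vf fn]; split => //.
    apply: leq_trans (compl_C_le_rksum_sq b0 m Vf) _; rewrite leq_mul2l.
    apply/orP; right; apply: leq_trans (rksum_sq_le b S f) _.
    by rewrite leq_exp2r// -(compl_NE b0).
  + by rewrite muln0.
  + by move=> k; rewrite ltn_mul2l K0 ltn_exp2r ?ltnSn.
  + move=> k; have -> : (K * k.+1 ^ 2 - K * k ^ 2 = K * (2 * k).+1)%N.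
      by rewrite -mulnBr; congr (_ * _)%N; rewrite -!mulnn; nia.
    rewrite mulnCA (mulnC 6%N) -mulnA leq_mul2l; apply/orP; right.
    have : (k * k <= K * k ^ 2)%N by rewrite -mulnn leq_pmull.
    move: (K * k ^ 2)%N => z; nia.
Qed.
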